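(* If $((A,\phi_0),(A^*,X_0))$ is a generalized Lie bialgebroid over $M$, then so is $((A^*,X_0),(A,\phi_0))$.
   Context: Lie algebroid $(A,[\,,\,],\rho)$ over $M$: real vector bundle $A\to M$, Lie bracket on $\Gamma(A)$, anchor $\rho:A\to TM$ inducing a Lie algebra homomorphism $\Gamma(A)\to\mathfrak X(M)$, with $[X,fY]=f[X,Y]+\rho(X)(f)Y$. Its differential $d:\Gamma(\wedge^kA^* )\to\Gamma(\wedge^{k+1}A^* )$ is $(d\omega)(X_0,\dots,X_k)=\sum_i(-1)^i\rho(X_i)(\omega(\dots,\hat X_i,\dots))+\sum_{i<j}(-1)^{i+j}\omega([X_i,X_j],\dots,\hat X_i,\dots,\hat X_j,\dots)$. $\phi_0\in\Gamma(A^* )$ is a 1-cocycle if $d\phi_0=0$. Schouten bracket on $\Gamma(\wedge^*A)$: the $\mathbb R$-bilinear extension of the bracket with $[X,f]=\rho(X)(f)$, $[P,P']=(-1)^{kk'}[P',P]$, $[P,P'\wedge P'']=[P,P']\wedge P''+(-1)^{k'(k+1)}P'\wedge[P,P'']$ ($k,k'$ the degrees of $P,P'$). For a 1-cocycle $\phi_0$ of $A$: the $\phi_0$-differential is $d_{\phi_0}\omega=d\omega+\phi_0\wedge\omega$; the $\phi_0$-Lie derivative on $\Gamma(\wedge^kA^* )$ is $(\mathcal L_{\phi_0})_X=d_{\phi_0}\circ i_X+i_X\circ d_{\phi_0}$; the $\phi_0$-Schouten bracket is $[P,P']_{\phi_0}=[P,P']+(-1)^{k+1}(k-1)P\wedge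 i_{\phi_0}P'-(k'-1)(i_{\phi_0}P)\wedge P'$ (contraction in the first slot); for $P\in\Gamma(\wedge^kA)$, $(\mathcal L_{\phi_0})_XP=[X,P]_{\phi_0}$. Generalized Lie bialgebroid: let $A\to M$ be a vector bundle with Lie algebroid structures $([\,,\,],\rho)$ on $A$ and $([\,,\,]_*,\rho_* )$ on the dual bundle $A^*$, $\phi_0\in\Gamma(A^* )$ a 1-cocycle of $A$ and $X_0\in\Gamma(A)$ a 1-cocycle of $A^*$. Let $d_*$, $d_{*X_0}$, $\mathcal L_{*X_0}$ be the differential, $X_0$-differential and $X_0$-Lie derivative of $A^*$ (acting on $\Gamma(\wedge^kA)$). The pair $((A,\phi_0),(A^*,X_0))$ is a generalized Lie bialgebroid over $M$ if for all $X,Y\in\Gamma(A)$ and $P\in\Gamma(\wedge^kA)$ (all $k$): $$d_{*X_0}[X,Y]=[X,d_{*X_0}Y]_{\phi_0}-[Y,d_{*X_0}X]_{\phi_0},\qquad(\mathcal L_{*X_0})_{\phi_0}P+(\mathcal L_{\phi_0})_{X_0}P=0.$$ The pair $((A^*,X_0),(A,\phi_0))$ is obtained by interchanging the roles of the two Lie algebroids and the two cocycles, identifying $(A^* )^*=A$. *)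

(* Defs.v *)
From HB Require Import structures.
From mathcomp Require Import all_boot all_order all_algebra.
From mathcomp Require Import all_classical all_reals all_analysis.
Set Implicit Arguments.
Unset Strict Implicit.
Unset Printing Implicit Defensive.
Import Order.TTheory GRing.Theory Num.Theory.
Import numFieldNormedType.Exports.
Local Open Scope classical_set_scope.
Local Open Scope ring_scope.

(* Conventions.  Functions, sections and tensor fields are total Rocq functions
   together with a smoothness predicate; operators on them are only constrained
   on smooth arguments.  A section of a bundle E is a dependent function
   forall x, E x. *)

(** * Smooth manifolds *)

Fixpoint Ck (R : realType) n (k : nat) (f : 'rV[R]_n -> R)
    (U : set 'rV[R]_n) : Prop :=
  {in U, continuous f} /\
  (if k is k'.+1 then
     forall i : 'I_n,
       (forall x, U x -> derivable f x (delta_mx 0 i)) /\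
       Ck k' (fun x => 'D_(delta_mx 0 i) f x) U
   else True).

Definition Cinfty (R : realType) n (f : 'rV[R]_n -> R) (U : set 'rV[R]_n) :=
  forall k, Ck k f U.

Record chart (R : realType) (T : topologicalType) (n : nat) := Chart {
  cdom : set T;
  cmap : T -> 'rV[R]_n;
  cinv : 'rV[R]_n -> T }.

Definition cimg (R : realType) (T : topologicalType) n (c : chart R T n)
  (W : set T) : set 'rV[R]_n := cmap c @` (W `&` cdom c).

Definition is_chart (R : realType) (T : topologicalType) n (c : chart R T n) :=
  [/\ open (cdom c), open (cimg c setT),
      (forall x, cdom c x -> cinv c (cmap c x) = x),
      {in cdom c, continuous (cmap c)} &
      {in cimg c setT, continuous (cinv c)}].

Record manifold (R : realType) := Manifold {
  msort :> topologicalType;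
  mdim : nat;
  atlas : set (chart R msort mdim);
  m_hausdorff : hausdorff_space msort;
  m_second_countable : @second_countable msort;
  m_chart : forall c, atlas c -> is_chart c;
  m_cover : forall x : msort, exists2 c, atlas c & cdom c x;
  m_compat : forall c c', atlas c -> atlas c' -> forall i : 'I_mdim,
    Cinfty (fun y => cmap c' (cinv c y) 0 i) (cimg c (cdom c')) }.

Definition smooth_on (R : realType) (M : manifold R) (W : set M) (f : M -> R) :=
  forall c, atlas c -> Cinfty (f \o cinv c) (cimg c W).

Definition smooth (R : realType) (M : manifold R) (f : M -> R) :=
  smooth_on setT f.

Lemma Ck_eq (R : realType) n k (f g : 'rV[R]_n -> R) (U : set 'rV[R]_n) :
  open U -> (forall x, U x -> f x = g x) -> Ck k f U -> Ck k g U.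
Proof.
move=> oU.
have nfg (h h' : 'rV[R]_n -> R) x :
    (forall x, U x -> h x = h' x) -> U x -> \forall y \near x, h y = h' y.
  by move=> hh' Ux; near=> y; apply: hh'; near: y; exact: open_nbhs_nbhs.
elim: k f g => [|k IH] f g fg /= [cf df].
- split => // x xU; have Ux : U x by rewrite inE in xU.
  rewrite /continuous_at -(fg _ Ux); apply: cvg_trans (cf x xU).
  exact: (@near_eq_cvg _ _ (nbhs x) _ f g (nfg f g x fg Ux)).
- split.
    move=> x xU; have Ux : U x by rewrite inE in xU.
    rewrite /continuous_at -(fg _ Ux); apply: cvg_trans (cf x xU).
    exact: (@near_eq_cvg _ _ (nbhs x) _ f g (nfg f g x fg Ux)).
  move=> i; have [d1 d2] := df i; split.
    by move=> x Ux; apply: near_eq_derivable (d1 x Ux); apply: (nfg f g).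
  by apply: IH d2 => x Ux; apply: near_eq_derive; apply: (nfg f g).
Unshelve. all: by end_near. Qed.

Lemma cimg_open (R : realType) (T : topologicalType) n (c : chart R T n) W :
  is_chart c -> open W -> open (cimg c W).
Proof.
move=> [od oi K cc ci] oW.
rewrite (_ : cimg c W = cimg c setT `&` cinv c @^-1` W).
  by have /(continuous_inP _ oi) := ci; exact.
apply/seteqP; split => y /=.
  move=> [x [Wx dx] <-]; split; first by exists x.
  by rewrite K.
by move=> [[x [_ dx] <-]]; rewrite K // => Wx; exists x.
Qed.

Lemma smooth_on_eq (R : realType) (M : manifold R) (W : set M) (f g : M -> R) :
  open W -> (forall x, W x -> f x = g x) -> smooth_on W f -> smooth_on W g.
Proof.
move=> oW fg sf c ac k; apply: Ck_eq (sf c ac k).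
  by apply: cimg_open => //; exact: m_chart.
move=> _ [x [Wx dx] <-] /=; have [_ _ K _ _] := m_chart ac.
by rewrite K //; exact: fg.
Qed.

(* Tangent vectors at x are the derivations at x of the algebra of smooth
   functions; their values on non-smooth functions are irrelevant. *)
Definition is_tangent (R : realType) (M : manifold R) (x : M)
    (D : (M -> R) -> R) :=
  (forall a f g, smooth f -> smooth g ->
     D (fun y => a * f y + g y) = a * D f + D g) /\
  (forall f g, smooth f -> smooth g ->
     D (fun y => f y * g y) = f x * D g + g x * D f).

(** * Vector bundles *)

Record frame (R : realType) (T : topologicalType) (E : T -> vectType R)
    (r : nat) := Frame {
  fdom : set T;
  fvec : forall x, r.-tuple (E x) }.

(* A bundle is a family of fibres with a cover by local frames whose transition
   functions are smooth; this is the same thing as a total space with local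
   trivialisations. *)
Record bundle (R : realType) (M : manifold R) := Bundle {
  fibre :> M -> vectType R;
  rank : nat;
  frames : set (frame fibre rank);
  b_open : forall e, frames e -> open (fdom e);
  b_basis : forall e, frames e -> forall x, fdom e x ->
    basis_of fullv (fvec e x);
  b_cover : forall x : M, exists2 e, frames e & fdom e x;
  b_compat : forall e e', frames e -> frames e' -> forall i j : 'I_rank,
    smooth_on (fdom e `&` fdom e')
      (fun x => coord (fvec e' x) j (tnth (fvec e x) i)) }.

Definition sec (R : realType) (M : manifold R) (E : bundle M) :=
  forall x : M, E x.

Definition smooth_sec (R : realType) (M : manifold R) (E : bundle M)
    (X : sec E) :=
  forall e : frame E (rank E), frames e -> forall i,
    smooth_on (fdom e) (fun x => coord (fvec e x) i (X x)).

Definition secD (R : realType) (M : manifold R) (E : bundle M) (X Y : sec E) :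
  sec E := fun x => X x + Y x.
Definition secZ (R : realType) (M : manifold R) (E : bundle M) (f : M -> R)
  (X : sec E) : sec E := fun x => f x *: X x.

Section Dual.
Variables (R : realType) (M : manifold R) (E : bundle M).

Definition dual_fibre (x : M) : vectType R := 'Hom(E x, R^o).

Definition dual_frame (e : frame E (rank E)) : frame dual_fibre (rank E) :=
  Frame (fdom e) (fun x =>
    [tuple (linfun (coord (fvec e x) i : E x -> R^o) : dual_fibre x)
      | i < rank E]).

Lemma dual_frame_basis (e : frame E (rank E)) x :
  frames e -> fdom e x -> basis_of fullv (fvec (dual_frame e) x).
Proof.
move=> fe ex; have be := b_basis fe ex.
have fr := basis_free be.
rewrite basisEdim size_tuple; apply/andP; split; last first.
  have := size_basis be; rewrite !dimvf => <-.
  by rewrite [dim (dual_fibre x)]/dim /= muln1.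
apply/subvP => l _.
have -> : l = \sum_i l (tnth (fvec e x) i) *: tnth (fvec (dual_frame e) x) i.
  apply/lfunP => v; rewrite sum_lfunE.
  rewrite {1}(coord_basis be (memvf v)) linear_sum; apply: eq_bigr => i _.
  rewrite scale_lfunE tnth_mktuple lfunE linearZ /= (tnth_nth 0).
  by rewrite /GRing.scale /= mulrC.
by apply: memv_suml => i _; apply: memvZ; apply: memv_span; exact: mem_tnth.
Qed.

Lemma coord_dual_frame (e : frame E (rank E)) (x : M) i (l : dual_fibre x) :
  frames e -> fdom e x ->
  coord (fvec (dual_frame e) x) i l = l (tnth (fvec e x) i).
Proof.
move=> fe ex; have be := b_basis fe ex.
have bd := dual_frame_basis fe ex.
rewrite [in RHS](coord_basis bd (memvf l)) sum_lfunE (bigD1 i) //= big1.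
  rewrite addr0 scale_lfunE (nth_mktuple _ _ _) lfunE /= (tnth_nth 0).
  by rewrite coord_free ?(basis_free be)// eqxx /GRing.scale /= mulr1.
move=> j ji; rewrite scale_lfunE (nth_mktuple _ _ _) lfunE /= (tnth_nth 0).
rewrite coord_free ?(basis_free be)// eq_sym (negPf ji).
by rewrite /GRing.scale /= mulr0.
Qed.

Definition dual_frames : set (frame dual_fibre (rank E)) :=
  dual_frame @` (@frames R M E).

Lemma dual_open e : dual_frames e -> open (fdom e).
Proof. by case=> e0 fe0 <-; exact: (b_open fe0). Qed.

Lemma dual_basis e : dual_frames e -> forall x, fdom e x ->
  basis_of fullv (fvec e x).
Proof. by case=> e0 fe0 <- x ex; exact: dual_frame_basis. Qed.

Lemma dual_cover (x : M) : exists2 e, dual_frames e & fdom e x.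
Proof.
have [e fe ex] := b_cover E x; exists (dual_frame e) => //.
by exists e.
Qed.

Lemma dual_compat e e' : dual_frames e -> dual_frames e' ->
  forall i j : 'I_(rank E), smooth_on (fdom e `&` fdom e')
    (fun x => coord (fvec e' x) j (tnth (fvec e x) i)).
Proof.
case=> e0 fe <- [e1 fe1 <-] i j.
apply: (@smooth_on_eq _ _ _
  (fun x => coord (fvec e0 x) i (tnth (fvec e1 x) j))).
- by apply: openI; [exact: (b_open fe)|exact: (b_open fe1)].
- move=> x [/= ex e1x]; rewrite coord_dual_frame //.
  by rewrite tnth_mktuple lfunE.
- by rewrite /= setIC; exact: b_compat.
Qed.

(* Fibre of A^* at x: linear forms on the fibre of A; frames: dual frames. *)
Definition dual : bundle M :=
  Bundle dual_open dual_basis dual_cover dual_compat.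

Definition ev (x : M) (v : E x) (l : dual x) : R := l v.
(* The identification of A with the dual of A^*. *)
Definition coev (x : M) (l : dual x) (v : E x) : R := l v.

End Dual.

(** * Sections of the exterior powers *)

(* A field of forms of degree k on E, i.e. a section of the k-th exterior power
   of E^*, sends x and a list of k vectors of E x to a number; it is extended
   by 0 to lists of other lengths, so that forms of all degrees live in one
   type.  Sections of the k-th exterior power of A are the forms of degree k
   on A^*. *)
Definition cochain (R : realType) (M : manifold R) (E : bundle M) :=
  forall x : M, seq (E x) -> R.

Record is_form (R : realType) (M : manifold R) (E : bundle M) (k : nat)
    (w : cochain E) : Prop := IsForm {
  form_degree : forall x s, size s != k -> w x s = 0;
  form_linear : forall x s1 s2 a (u v : E x),
    w x (s1 ++ (a *: u + v) :: s2) =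
    a * w x (s1 ++ u :: s2) + w x (s1 ++ v :: s2);
  form_alternating : forall x s1 s2 s3 (u : E x),
    w x (s1 ++ u :: s2 ++ u :: s3) = 0;
  form_smooth : forall e : frame E (rank E), frames e ->
    forall I : seq 'I_(rank E),
    smooth_on (fdom e) (fun x => w x [seq tnth (fvec e x) i | i <- I]) }.

Section Cochains.
Variables (R : realType) (M : manifold R) (E : bundle M).
Implicit Types (w t : cochain E).

Definition cochain0 : cochain E := fun _ _ => 0.
Definition cochainD w t : cochain E := fun x s => w x s + t x s.
Definition cochainZ (a : R) w : cochain E := fun x s => a * w x s.

Definition of_fun (f : M -> R) : cochain E :=
  fun x s => if s is [::] then f x else 0.

(* A section X of A as a form of degree 1 on E, for a pairing A x E -> R. *)
Definition of_sec (A : bundle M) (p : forall x, A x -> E x -> R) (X : sec A) :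
    cochain E :=
  fun x s => if s is [:: v] then p x (X x) v else 0.

Definition contract (X : sec E) w : cochain E := fun x s => w x (X x :: s).

(* (w /\ t)(v_1, ..., v_n): sum over shuffles, encoded by the mask m of the
   arguments given to w; inversions m counts the inversions of the shuffle, so
   that (a /\ b)(u, v) = a(u) b(v) - a(v) b(u) in degree 1. *)
Definition inversions (m : bitseq) : nat :=
  (\sum_(j < size m) \sum_(i < j) (nth false m j && ~~ nth false m i))%N.

Definition wedge w t : cochain E := fun x s =>
  \sum_(m : (size s).-tuple bool)
    (-1) ^+ inversions m * w x (mask m s) * t x (mask (map negb m) s).

End Cochains.

Arguments cochain0 {R M} E x s.
Arguments of_fun {R M} E f x s.

(** * Lie algebroids *)

Record lie_algebroid (R : realType) (M : manifold R) (E : bundle M) :=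
    LieAlgebroid {
  bracket : sec E -> sec E -> sec E;
  anchor : forall x, E x -> (M -> R) -> R;
  bracket_smooth : forall X Y, smooth_sec X -> smooth_sec Y ->
    smooth_sec (bracket X Y);
  bracket_linear : forall a X Y Z,
    smooth_sec X -> smooth_sec Y -> smooth_sec Z ->
    bracket (secD (secZ (fun _ => a) X) Y) Z =
    secD (secZ (fun _ => a) (bracket X Z)) (bracket Y Z);
  bracket_skew : forall X Y, smooth_sec X -> smooth_sec Y ->
    bracket X Y = secZ (fun _ => -1) (bracket Y X);
  bracket_jacobi : forall X Y Z,
    smooth_sec X -> smooth_sec Y -> smooth_sec Z ->
    bracket X (bracket Y Z) =
    secD (bracket (bracket X Y) Z) (bracket Y (bracket X Z));
  anchor_tangent : forall x (u : E x), is_tangent x (anchor u);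
  anchor_linear : forall x a (u v : E x) f, smooth f ->
    anchor (a *: u + v) f = a * anchor u f + anchor v f;
  anchor_smooth : forall X f, smooth_sec X -> smooth f ->
    smooth (fun x => anchor (X x) f);
  anchor_bracket : forall X Y f, smooth_sec X -> smooth_sec Y -> smooth f ->
    forall x, anchor (bracket X Y x) f =
      anchor (X x) (fun y => anchor (Y y) f) -
      anchor (Y x) (fun y => anchor (X y) f);
  bracket_leibniz : forall X Y f, smooth_sec X -> smooth_sec Y -> smooth f ->
    bracket X (secZ f Y) =
    secD (secZ f (bracket X Y)) (secZ (fun x => anchor (X x) f) Y) }.

Section Differential.
Variables (R : realType) (M : manifold R) (E : bundle M).
Variable (L : lie_algebroid E).

Definition sec0 : sec E := fun _ => 0.

Definition eval_at (x : M) (Xs : seq (sec E)) : seq (E x) :=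
  [seq X x | X <- Xs].

Definition omit (T : Type) (i : nat) (s : seq T) := take i s ++ drop i.+1 s.

Definition diff_sec (w : cochain E) (Xs : seq (sec E)) (x : M) : R :=
  \sum_(i < size Xs)
    (-1) ^+ i * anchor L (nth sec0 Xs i x)
                  (fun y => w y (eval_at y (omit i Xs))) +
  \sum_(j < size Xs) \sum_(i < j)
    (-1) ^+ (i + j) *
    w x (eval_at x (bracket L (nth sec0 Xs i) (nth sec0 Xs j) ::
                    omit i (omit j Xs))).

(* A chosen smooth section with value v at x. *)
Definition sec_through (x : M) (v : E x) : sec E :=
  if pselect (exists X : sec E, smooth_sec X /\ X x = v) is left h
  then sval (cid h) else sec0.

(* The value of dw on v_0, ..., v_k in E x is that of the formula for d on
   sections extending the v_i; on forms it does not depend on the sections. *)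
Definition diff (w : cochain E) : cochain E :=
  fun x s => diff_sec w [seq sec_through v | v <- s] x.

(* phi is the 1-cocycle, seen as a form of degree 1. *)
Definition tdiff (phi w : cochain E) : cochain E :=
  cochainD (diff w) (wedge phi w).

Definition tlie (phi : cochain E) (X : sec E) (w : cochain E) : cochain E :=
  cochainD (tdiff phi (contract X w)) (contract X (tdiff phi w)).

End Differential.

(** * Schouten brackets *)

(* The Schouten bracket of a Lie algebroid A, on multivector fields seen as
   forms on B, where the pairing p identifies B with A^*.  These properties
   determine it on smooth multivector fields. *)
Record schouten (R : realType) (M : manifold R) (A B : bundle M)
    (p : forall x, A x -> B x -> R) (L : lie_algebroid A) := Schouten {
  sch : cochain B -> cochain B -> cochain B;
  sch_degree : forall k k' P P', is_form k P -> is_form k' P' ->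
    (0 < k + k')%N -> is_form (k + k').-1 (sch P P');
  sch_fun_fun : forall f g, smooth f -> smooth g ->
    sch (of_fun B f) (of_fun B g) = cochain0 B;
  sch_linear_l : forall k k' a P Q P',
    is_form k P -> is_form k Q -> is_form k' P' ->
    sch (cochainD (cochainZ a P) Q) P' =
    cochainD (cochainZ a (sch P P')) (sch Q P');
  sch_linear_r : forall k k' a P P' Q',
    is_form k P -> is_form k' P' -> is_form k' Q' ->
    sch P (cochainD (cochainZ a P') Q') =
    cochainD (cochainZ a (sch P P')) (sch P Q');
  sch_sec_sec : forall X Y, smooth_sec X -> smooth_sec Y ->
    sch (of_sec p X) (of_sec p Y) = of_sec p (bracket L X Y);
  sch_sec_fun : forall X f, smooth_sec X -> smooth f ->
    sch (of_sec p X) (of_fun B f) = of_fun B (fun x => anchor L (X x) f);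
  sch_sym : forall k k' P P', is_form k P -> is_form k' P' ->
    sch P P' = cochainZ ((-1) ^+ (k * k')) (sch P' P);
  sch_leibniz : forall k k' k'' P P' P'',
    is_form k P -> is_form k' P' -> is_form k'' P'' ->
    sch P (wedge P' P'') =
    cochainD (wedge (sch P P') P'')
      (cochainZ ((-1) ^+ (k' * k.+1)) (wedge P' (sch P P''))) }.

(* The phi-Schouten bracket of multivector fields of degrees k and k'. *)
Definition tsch (R : realType) (M : manifold R) (A B : bundle M)
    (p : forall x, A x -> B x -> R) (L : lie_algebroid A) (S : schouten p L)
    (phi : sec B) (k k' : nat) (P P' : cochain B) : cochain B :=
  cochainD (sch S P P')
    (cochainD
      (cochainZ ((-1) ^+ k.+1 * (k%:R - 1)) (wedge P (contract phi P')))
      (cochainZ (- (k'%:R - 1)) (wedge (contract phi P) P'))).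

(** * Generalized Lie bialgebroids *)

(* ((A, phi0), (B, X0)) is a generalized Lie bialgebroid, where the pairing p
   identifies B with A^*. *)
Record gen_lie_bialgebroid (R : realType) (M : manifold R) (A B : bundle M)
    (p : forall x, A x -> B x -> R)
    (LA : lie_algebroid A) (LB : lie_algebroid B) (S : schouten p LA)
    (phi0 : sec B) (X0 : sec A) : Prop := GenLieBialgebroid {
  glb_phi0_smooth : smooth_sec phi0;
  glb_X0_smooth : smooth_sec X0;
  glb_phi0_cocycle :
    diff LA (of_sec (fun x b a => p x a b) phi0) = cochain0 A;
  glb_X0_cocycle : diff LB (of_sec p X0) = cochain0 B;
  glb_bracket : forall X Y : sec A, smooth_sec X -> smooth_sec Y ->
    tdiff LB (of_sec p X0) (of_sec p (bracket LA X Y)) =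
    cochainD
      (tsch S phi0 1 2 (of_sec p X) (tdiff LB (of_sec p X0) (of_sec p Y)))
      (cochainZ (-1)
        (tsch S phi0 1 2 (of_sec p Y) (tdiff LB (of_sec p X0) (of_sec p X))));
  glb_lie : forall k P, is_form k P ->
    cochainD (tlie LB (of_sec p X0) phi0 P)
             (tsch S phi0 1 k (of_sec p X0) P) = cochain0 B }.

Arguments gen_lie_bialgebroid {R M A B p} LA LB S phi0 X0.

(* Main.v *)
Require Import Defs.
From mathcomp Require Import all_boot all_order all_algebra.
From mathcomp Require Import all_classical all_reals all_analysis.
From mathcomp Require Import ring lra zify.
Set Implicit Arguments.
Unset Strict Implicit.
Unset Printing Implicit Defensive.
Import Order.TTheory GRing.Theory Num.Theory.
Import numFieldNormedType.Exports.
Import Defs.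
Local Open Scope classical_set_scope.
Local Open Scope ring_scope.

(* Evaluated on sections, both axioms become identities between functions:
   [X, P] is the Lie derivative of the multivector field P (by induction on the
   degree, since near each point k P = sum_i E_i /\ i_{F_i} P for dual frames),
   and i_X d + d i_X is the Lie derivative of forms.

   The second axiom in degrees 0 and 1 says that <phi0, X0> = 0, that the anchors
   of phi0 and X0 are opposite and that L_{*phi0} X = - [X0, X]; these conditions
   are self-dual and imply the dual axiom in every degree, both sides being
   derivations of the exterior product.

   Let C(X, Y) be the difference of the two sides of the first axiom.  Replacing Y
   by f Y shows that C(X, f Y) - f C(X, Y) is O(X, f) /\ Y, so C = 0 forces
   O(X, f) = 0 in rank at least 2, and comparing O(g X, f) with g O(X, f) gives
   the skew-symmetry of {f, g} = <df, d_* g>.  The dual defect D satisfies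
   C(X, Y)(al, be) - D(al, be)(X, Y) = a combination of terms E(X, al)<Y, be>, and
   O = 0 identifies E(X, al) f with - {f, g} - X0(f) g + f X0(g) for g = <X, al>,
   which is skew in f and g, so that the combination vanishes. *)

(** * Smooth functions and bump functions *)

(** The operators obey their laws only on globally smooth arguments, while frames are local. Hence
    the bump functions: local expansions are multiplied by a cutoff equal to 1 at the point of
    interest, and vectors are extended to global sections. Since A is not literally the dual of
    [dual A], the argument runs for two bundles A, B with pairings p and q that agree up to
    flipping, as [ev] and [coev] do, so that each lemma can be used with the roles exchanged.

    The bracket axiom is known on one side only, so what is needed about E must be drawn from C. The
    skew expression of the overview has a meaning: -E(X, al) f = {f, g} + X0(f) g - f X0(g) equals
    <df + f phi0, d_* g + g X0>, the Jacobi bracket that the bialgebroid induces on functions on M.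
    Its skew-symmetry, at points where two independent vectors exist, is what makes the dual defect
    vanish. *)

Section FlatFunctions.
Variable R : realType.
Implicit Types (p : {poly R}) (t : R).

(** The family of functions p(1/t) exp(-1/t) is closed under differentiation, so smoothness of the
    classical flat function becomes an induction over all polynomials p at once. *)
Definition flat p t : R := if 0 < t then p.[t^-1] * expR (- t^-1) else 0.

Lemma horner_expR_bounded p :
  exists2 C : R, 0 <= C & forall s, 0 <= s -> `|p.[s] * expR (- s)| <= C.
Proof.
(* From s ^ i <= i! exp(s), one coefficient at a time. *)
exists (\sum_(i < size p) `|p`_i| * i`!%:R).
  by apply: sumr_ge0 => i _; rewrite mulr_ge0.
move=> s s0; rewrite horner_coef mulr_suml; apply: le_trans (ler_norm_sum _ _ _) _.
apply: ler_sum => i _; rewrite -mulrA normrM ler_wpM2l// normrM.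
rewrite (ger0_norm (expR_ge0 _)) ger0_norm ?exprn_ge0//.
rewrite expRN ler_pdivrMr ?expR_gt0//.
case: i => -[|i] ilt /=; first by rewrite expr0 mul1r -expR0 ler_expR.
have := expR_ge1Dxn i s0 => /(ler_wpM2l (ler0n R i.+1`!)).
by apply: le_trans; rewrite mulrDr mulrCA mulfV ?mulr1 ?lerDr.
Qed.

(** Since p(1/t) = t (1/t) p(1/t), the bound for ['X * p] gains a factor t. *)
Lemma flat_le p : exists2 C : R, 0 <= C & forall t, `|flat p t| <= C * `|t|.
Proof.
have [C C0 pC] := horner_expR_bounded ('X * p); exists C => // t.
rewrite /flat; case: ifPn => [t0|_]; last by rewrite normr0 mulr_ge0.
have := pC t^-1; rewrite invr_ge0 (ltW t0) => /(_ isT) /(ler_wpM2r (normr_ge0 t)).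
apply: le_trans; rewrite -normrM !hornerE.
rewrite [leRHS](_ : _ = `|p.[t^-1] * expR (- t^-1)|)//; congr `|_|; field.
by rewrite gt_eqF.
Qed.

Lemma flat_is_derive p t :
  is_derive t (1 : R) (flat p) (flat ('X^2 * (p - p^`())) t).
Proof.
have [t0|t0|->] := ltgtP t 0.
- rewrite [flat (_ * _) t]/flat ltNge (ltW t0) /=.
  apply: (@near_eq_is_derive _ _ _ (cst (0 : R))).
  near=> u; rewrite /flat /= ltNge ifF //; apply/negbF; rewrite ltW //.
  by near: u; apply: lt_nbhsl.
- have tn0 : t != 0 by rewrite gt_eqF.
  have dV : is_derive t (1 : R) (fun u : R => u^-1) (- t ^- 2).
    by apply: is_derive_eq (is_deriveV _ (is_derive_id _ _)) _; rewrite // scaler1.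
  have dp := is_derive1_comp (is_derive_poly p t^-1) dV.
  have de : is_derive t (1 : R) (fun u : R => expR (- u^-1)) (expR (- t^-1) * t ^- 2).
    have := @is_derive1_comp _ expR (fun u : R => - u^-1) t _ _
      (is_derive_expR _) (is_deriveN dV).
    by rewrite opprK.
  have -> : flat ('X^2 * (p - p^`())) t =
      p.[t^-1] *: (expR (- t^-1) * t ^- 2) + expR (- t^-1) *: (p^`().[t^-1] * - t ^- 2).
    by rewrite /flat t0 !hornerE /GRing.scale /= -exprVn; ring.
  apply: near_eq_is_derive (is_deriveM dp de).
  near=> u; rewrite /flat ifT //; near: u; exact: lt_nbhsr.
(* At 0 the difference quotient of [flat p] is [flat ('X * p)], which is continuous there by the
   linear bound. *)
- rewrite {2}/flat ltxx; apply/is_derive1_caratheodory.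
  exists (flat ('X * p)); split; last by rewrite /flat ltxx.
    move=> z; rewrite /flat ltxx !subr0; case: ifPn => [z0|_]; last by rewrite mul0r.
    by rewrite !hornerE; field; rewrite gt_eqF.
  have [C C0 pC] := flat_le ('X * p).
  suff : flat ('X * p) z @[z --> 0] --> (0 : R).
    by rewrite /prop_for /continuous_at [flat _ 0]/flat ltxx.
  apply/cvgr0Pnorm_lt => e e0; near=> z.
  apply: le_lt_trans (pC z) _; apply: (@le_lt_trans _ _ ((C + 1) * `|z|)).
    by rewrite ler_wpM2r// lerDl.
  rewrite mulrC -ltr_pdivlMr ?ltr_wpDl//; near: z.
  apply: cvgr0_norm_lt; first exact: cvg_id.
  by rewrite divr_gt0// ltr_wpDl.
Unshelve. all: by end_near. Qed.

Lemma flat_gt0 t : 0 < t -> 0 < flat 1 t.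
Proof. by move=> t0; rewrite /flat t0 hornerE mul1r expR_gt0. Qed.

Lemma flat_le0 p t : t <= 0 -> flat p t = 0.
Proof. by rewrite /flat ltNge => ->. Qed.

End FlatFunctions.

(** * Calculus of [Ck] functions *)

Section CkTheory.
Variables (R : realType) (n : nat).
Implicit Types (f g : 'rV[R]_n -> R) (U V : set 'rV[R]_n).

Lemma CkS k f U : Ck k.+1 f U -> Ck k f U.
Proof.
elim: k f => [|k IH] f /= [cf df]; split=> // i.
by have [d1 d2] := df i; split=> //; exact: IH.
Qed.

(** [Ck] is a conjunction of conditions at the points of U, each on the germ of f in the whole
    space; hence V need not be open. *)
Lemma Ck_local k f U :
  (forall x, U x -> exists2 V, V x & Ck k f V) -> Ck k f U.
Proof.
elim: k f => [|k IH] f h /=.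
  split=> // x; rewrite inE => /h [V Vx [cf _]]; exact: cf (mem_set Vx).
split.
  move=> x; rewrite inE => /h [V Vx [cf _]]; exact: cf (mem_set Vx).
move=> i; split=> [x /h[V Vx [_ /(_ i)[d1 _]]]|]; first exact: d1.
by apply: IH => x /h[V Vx [_ /(_ i)[_ d2]]]; exists V.
Qed.

Lemma Ck_cst k (a : R) U : Ck k (fun=> a) U.
Proof.
have cc (b : R) : {in U, continuous (fun _ : 'rV[R]_n => b)}.
  by move=> x _; exact: cst_continuous.
elim: k a => [|k IH] a /=; split=> //.
move=> i; split=> [x _|]; first exact: derivable_cst.
rewrite [X in Ck k X](_ : _ = fun=> 0); first exact: IH.
by apply/funext => x; exact: (derive_cst a).
Qed.

Lemma CkD k f g U : open U -> Ck k f U -> Ck k g U ->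
  Ck k (fun x => f x + g x) U.
Proof.
move=> oU; elim: k f g => [|k IH] f g /= [cf df] [cg dg]; split=> //.
- by move=> x xU; apply: continuousD; [exact: cf|exact: cg].
- by move=> x xU; apply: continuousD; [exact: cf|exact: cg].
move=> i; have [df1 df2] := df i; have [dg1 dg2] := dg i; split.
  by move=> x Ux; apply: derivableD; [exact: df1|exact: dg1].
apply: (Ck_eq oU _ (IH _ _ df2 dg2)) => x Ux.
by rewrite -deriveD//; [exact: df1|exact: dg1].
Qed.

Lemma CkM k f g U : open U -> Ck k f U -> Ck k g U ->
  Ck k (fun x => f x * g x) U.
Proof.
move=> oU; elim: k f g => [|k IH] f g Cf Cg.
  case: Cf Cg => cf _ [cg _]; split=> // x xU.
  by apply: continuousM; [exact: cf|exact: cg].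
have fk := CkS Cf; have gk := CkS Cg.
move: Cf Cg => /= [cf df] [cg dg]; split.
  by move=> x xU; apply: continuousM; [exact: cf|exact: cg].
move=> i; have [df1 df2] := df i; have [dg1 dg2] := dg i; split.
  by move=> x Ux; apply: derivableM; [exact: df1|exact: dg1].
apply: (Ck_eq oU _ (CkD oU (IH _ _ fk dg2) (IH _ _ gk df2))) => x Ux.
by rewrite deriveM//; [exact: df1|exact: dg1].
Qed.

Lemma CkV k f U : open U -> (forall x, U x -> f x != 0) -> Ck k f U ->
  Ck k (fun x => (f x)^-1) U.
Proof.
move=> oU f0; elim: k => [|k IH] Cf.
  case: Cf => cf _; split=> // x xU.
  by apply: continuousV; [apply: f0; rewrite inE in xU|exact: cf].
have fk := IH (CkS Cf).
move: Cf => /= [cf df]; split.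
  by move=> x xU; apply: continuousV; [apply: f0; rewrite inE in xU|exact: cf].
move=> i; have [df1 df2] := df i; split.
  by move=> x Ux; apply: derivableV; [exact: f0|exact: df1].
apply: (Ck_eq oU _ (CkM oU (CkM oU fk fk) (CkM oU (@Ck_cst k (-1) U) df2))) => x Ux.
rewrite deriveV; [|exact: f0|exact: df1].
by rewrite /GRing.scale /= -exprVn expr2; ring.
Qed.

Lemma growth_rate_line f x v :
  (fun h : R => h^-1 *: ((f \o shift x) (h *: v) - f x)) =
  (fun h : R => h^-1 *: (((fun t : R => f (t *: v + x)) \o shift 0) (h *: 1) -
                         f (0 *: v + x))).
Proof.
by apply/funext => h /=; rewrite scale0r add0r addr0 [h *: 1]mulr1.
Qed.

Lemma derivable_line f x v :
  derivable f x v = derivable (fun t : R => f (t *: v + x)) 0 (1 : R).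
Proof. by rewrite /derivable growth_rate_line. Qed.

Lemma derive_line f x v :
  'D_v f x = 'D_(1 : R) (fun t : R => f (t *: v + x)) 0.
Proof. by rewrite /derive growth_rate_line. Qed.

(** [Ck] only provides partial derivatives; restricting f to the line through x along v makes the
    one-variable chain rule enough, without total differentiability. *)
Lemma is_derive_comp_line (h : R -> R) f x v dh :
  derivable f x v -> is_derive (f x) (1 : R) h dh ->
  is_derive x v (h \o f) (dh * 'D_v f x).
Proof.
move=> dfx dhx; pose l := fun t : R => f (t *: v + x).
have dl : is_derive (0 : R) (1 : R) l ('D_v f x).
  by rewrite derive_line; apply/derivableP; rewrite -derivable_line.
have dh' : is_derive (l 0) (1 : R) h dh by rewrite /l scale0r add0r.
have [e1 e2] := is_derive1_comp dh' dl.
by apply: DeriveDef; rewrite ?derivable_line// derive_line.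
Qed.

Lemma Ck_flat k p f U : open U -> Ck k f U -> Ck k (fun x => flat p (f x)) U.
Proof.
move=> oU; elim: k p => [|k IH] p Cf.
  case: Cf => cf _; split=> // x xU.
  apply: continuous_comp; first exact: cf.
  have [d _] := flat_is_derive p (f x).
  by apply/differentiable_continuous/derivable1_diffP.
have fk := IH ('X^2 * (p - p^`())) (CkS Cf).
move: Cf => /= [cf df]; split.
  move=> x xU; apply: continuous_comp; first exact: cf.
  have [d _] := flat_is_derive p (f x).
  by apply/differentiable_continuous/derivable1_diffP.
move=> i; have [df1 df2] := df i.
have dc x : U x -> is_derive x (delta_mx 0 i) (fun x => flat p (f x)) _ :=
  fun Ux => is_derive_comp_line (df1 x Ux) (flat_is_derive p (f x)).
split; first by move=> x /dc [].
by apply: (Ck_eq oU _ (CkM oU fk df2)) => x /dc [_ ->].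
Qed.

End CkTheory.

(** * Smooth functions on a manifold and cutoffs *)

Section SmoothFunctions.
Variables (R : realType) (M : manifold R).
Implicit Types (f g : M -> R) (W V : set M).

Lemma atlas_cimg_open (c : chart R M (mdim M)) W : atlas c -> open W -> open (cimg c W).
Proof. by move=> ac; apply: cimg_open; exact: m_chart. Qed.

Lemma smooth_on_local W f :
  (forall x, W x -> exists2 V, V x & smooth_on V f) -> smooth_on W f.
Proof.
move=> h c ac k; apply: Ck_local => _ [x [Wx cx] <-].
by have [V Vx fV] := h x Wx; exists (cimg c V); [exists x|exact: fV].
Qed.

Lemma smooth_on_sub W V f : W `<=` V -> smooth_on V f -> smooth_on W f.
Proof. by move=> WV fV; apply: smooth_on_local => x /WV Vx; exists V. Qed.

Lemma smooth_on_cst W (a : R) : smooth_on W (fun=> a).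
Proof. by move=> c ac k; exact: Ck_cst. Qed.

Lemma smooth_onD W f g : open W -> smooth_on W f -> smooth_on W g ->
  smooth_on W (fun x => f x + g x).
Proof.
by move=> oW sf sg c ac k; apply: CkD; [exact: atlas_cimg_open|exact: sf|exact: sg].
Qed.

Lemma smooth_onM W f g : open W -> smooth_on W f -> smooth_on W g ->
  smooth_on W (fun x => f x * g x).
Proof.
by move=> oW sf sg c ac k; apply: CkM; [exact: atlas_cimg_open|exact: sf|exact: sg].
Qed.

Lemma smooth_onZ W (a : R) f : open W -> smooth_on W f -> smooth_on W (fun x => a * f x).
Proof. by move=> oW; apply: smooth_onM => //; exact: smooth_on_cst. Qed.

Lemma smooth_onN W f : open W -> smooth_on W f -> smooth_on W (fun x => - f x).
Proof.
move=> oW /(smooth_onZ (-1) oW); congr smooth_on.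
by apply/funext => x; rewrite mulN1r.
Qed.

Lemma smooth_onV W f : open W -> (forall x, W x -> f x != 0) ->
  smooth_on W f -> smooth_on W (fun x => (f x)^-1).
Proof.
move=> oW f0 sf c ac k; apply: CkV; [exact: atlas_cimg_open| |exact: sf].
move=> _ [x [Wx cx] <-] /=; have [_ _ K _ _] := m_chart ac.
by rewrite K//; exact: f0.
Qed.

Lemma smooth_on_flat W p f : open W -> smooth_on W f ->
  smooth_on W (fun x => flat p (f x)).
Proof.
by move=> oW sf c ac k; apply: (@Ck_flat _ _ _ _ (f \o cinv c));
  [exact: atlas_cimg_open|exact: sf].
Qed.

Lemma smooth_on_sum W (I : Type) (r : seq I) (P : pred I) (F : I -> M -> R) :
  open W -> (forall i, P i -> smooth_on W (F i)) ->
  smooth_on W (fun x => \sum_(i <- r | P i) F i x).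
Proof.
move=> oW sF; elim: r => [|i r IH].
  rewrite [X in smooth_on _ X](_ : _ = fun=> 0); first exact: smooth_on_cst.
  by apply/funext => x; rewrite big_nil.
case Pi: (P i); last first.
  by move: IH; congr smooth_on; apply/funext => x; rewrite big_cons Pi.
have := smooth_onD oW (sF i Pi) IH; congr smooth_on.
by apply/funext => x; rewrite big_cons Pi.
Qed.

Lemma smooth_on_coordinate c i : atlas c ->
  smooth_on (cdom c) (fun x : M => cmap c x 0 i).
Proof. by move=> ac c' ac'; exact: m_compat. Qed.

Lemma open_cover_smooth W V f : W `|` V = setT ->
  smooth_on W f -> smooth_on V f -> smooth f.
Proof.
move=> WV fW fV; apply: smooth_on_local => x _.
have [Wx|Vx] : (W `|` V) x by rewrite WV.
  by exists W.
by exists V.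
Qed.

Lemma chart_ball (x : M) W : open W -> W x ->
  exists (c : chart R M (mdim M)) (r : R), [/\ atlas c, cdom c x, 0 < r &
    forall y : 'rV[R]_(mdim M),
      (forall i : 'I_(mdim M), `|y 0 i - cmap c x 0 i| <= r) -> cimg c W y].
Proof.
move=> oW Wx; have [c ac cx] := m_cover x.
have : nbhs (cmap c x) (cimg c W).
  by apply: open_nbhs_nbhs; split; [exact: atlas_cimg_open|exists x].
move=> /nbhs_ballP[r /= r0 h].
(* Halving the radius puts the closed cube inside the open ball. *)
exists c, (r / 2); split => // [|y hy]; first by rewrite divr_gt0.
apply: h; split => // i j; rewrite !ord1 /ball /= distrC.
by apply: le_lt_trans (hy j) _; rewrite ltr_pdivrMr// ltr_pMr// ltr1n.
Qed.

(* The bump is flat (r ^ 2 - |u - u(x)| ^ 2) in chart coordinates u; it vanishes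
   off the preimage of a closed cube, which is compact, hence closed because M
   is Hausdorff. *)
Lemma bump_exists (x : M) W : open W -> W x ->
  exists g (K : set M), [/\ smooth g, closed K, K `<=` W, g x = 1 &
    forall y, ~ K y -> g y = 0].
Proof.
move=> oW Wx; have [c [r [ac cx r0 rW]]] := chart_ball oW Wx.
have [oc oi KK cc ci] := m_chart ac.
pose Q : set 'rV[R]_(mdim M) :=
  [set y | forall i, `[cmap c x 0 i - r, cmap c x 0 i + r]%classic (y 0 i)].
have QE y : Q y -> forall i, `|y 0 i - cmap c x 0 i| <= r.
  by move=> Qy i; have := Qy i; rewrite /= in_itv /= ler_distl.
have cQ : compact Q.
  exact: (@rV_compact _ _
    (fun i => `[cmap c x 0 i - r, cmap c x 0 i + r]%classic)
    (fun i => @segment_compact _ _ _)).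
pose K : set M := cinv c @` Q.
have KW : K `<=` W `&` cdom c.
  by move=> _ [y /QE/rW[z [Wz cz] <-] <-]; rewrite KK.
have clK : closed K.
  apply: (compact_closed (@m_hausdorff _ M)).
  apply: continuous_compact => //; apply: continuous_in_subspaceT => y.
  rewrite inE => /QE/rW[z [Wz cz] <-]; apply: ci; rewrite inE.
  by exists z.
pose q (y : M) := \sum_(i < mdim M) (cmap c y 0 i - cmap c x 0 i) ^+ 2.
pose b (y : M) : R := if pselect (cdom c y) is left _ then flat 1 (r ^+ 2 - q y) else 0.
have bK y : ~ K y -> b y = 0.
  rewrite /b; case: pselect => // cy nKy; apply: flat_le0; rewrite subr_le0.
  rewrite leNgt; apply/negP => qr; apply: nKy; exists (cmap c y); last exact: KK.
  move=> i; rewrite /= in_itv /= -ler_distl.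
  set a := (X in `|X|); suff ar : a ^+ 2 <= r ^+ 2.
    by rewrite -(@ler_pXn2r _ 2%N) ?nnegrE ?(ltW r0)// real_normK ?num_real.
  apply: ltW; apply: le_lt_trans qr; rewrite /q (bigD1 i)//= lerDl.
  by apply: sumr_ge0 => j _; exact: sqr_ge0.
have bx : 0 < b x.
  rewrite /b; case: pselect => // _; apply: flat_gt0.
  rewrite /q big1; first by rewrite subr0 exprn_gt0.
  by move=> i _; rewrite subrr expr0n.
have sb : smooth b.
  apply: (@open_cover_smooth (cdom c) (~` K)).
  - apply/seteqP; split=> // y _ /=; have [Ky|nKy] := pselect (K y); last by right.
    by left; exact: (KW y Ky).2.
  - apply: (@smooth_on_eq _ _ _ (fun y => flat 1 (r ^+ 2 - q y))) => //.
      by move=> y cy; rewrite /b; case: pselect.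
    apply: smooth_on_flat => //; apply: smooth_onD => //; first exact: smooth_on_cst.
    apply: smooth_onN => //; apply: smooth_on_sum => // i _.
    have sd : smooth_on (cdom c) (fun y => cmap c y 0 i - cmap c x 0 i).
      apply: smooth_onD => //; first exact: smooth_on_coordinate.
      exact: smooth_on_cst.
    exact: smooth_onM.
  - apply: (@smooth_on_eq _ _ _ (fun=> 0)).
    + exact: closed_openC.
    + by move=> y /bK.
    + exact: smooth_on_cst.
exists (fun y => (b x)^-1 * b y), K; split => //.
- by apply: smooth_onZ => //; exact: openT.
- by move=> y /KW[].
- by rewrite mulVf// gt_eqF.
- by move=> y /bK ->; rewrite mulr0.
Qed.

Lemma smoothD f g : smooth f -> smooth g -> smooth (fun x => f x + g x).
Proof. by apply: smooth_onD; exact: openT. Qed.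

Lemma smoothM f g : smooth f -> smooth g -> smooth (fun x => f x * g x).
Proof. by apply: smooth_onM; exact: openT. Qed.

Lemma smoothN f : smooth f -> smooth (fun x => - f x).
Proof. by apply: smooth_onN; exact: openT. Qed.

Lemma smoothB f g : smooth f -> smooth g -> smooth (fun x => f x - g x).
Proof. by move=> sf sg; apply: smoothD => //; exact: smoothN. Qed.

Lemma smooth_cst (a : R) : smooth (fun _ : M => a).
Proof. exact: smooth_on_cst. Qed.

Lemma smooth_on_div g f W : smooth g -> smooth (fun y => g y * f y) ->
  (forall x, W x -> g x != 0) -> open W -> smooth_on W f.
Proof.
move=> sg sgf g0 oW.
apply: (@smooth_on_eq _ _ _ (fun y => (g y)^-1 * (g y * f y))) => //.
  by move=> y Wy; rewrite mulKf//; exact: g0.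
apply: smooth_onM => //; last exact: smooth_on_sub sgf.
by apply: smooth_onV => //; exact: smooth_on_sub sg.
Qed.

End SmoothFunctions.

(** * Sections and dual pairings *)

Section Sections.
Variables (R : realType) (M : manifold R).

Lemma smooth_continuous (f : M -> R) : smooth f -> continuous f.
Proof.
move=> sf x; have [c ac cx] := m_cover x.
have [oc _ K cc _] := m_chart ac.
have fc : {for x, continuous ((f \o cinv c) \o cmap c)}.
  apply: continuous_comp; first by apply: cc; rewrite inE.
  have [+ _] := sf c ac 0%N; apply; rewrite inE.
  by exists x.
rewrite /continuous_at -[in X in _ --> X](K _ cx); apply: cvg_trans fc.
apply: near_eq_cvg; near=> y; rewrite /= K//; near: y.
by apply: open_nbhs_nbhs.
Unshelve. all: by end_near. Qed.

Lemma open_neq0 (f : M -> R) : smooth f -> open [set x | f x != 0].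
Proof.
move=> /smooth_continuous cf.
rewrite (_ : mkset _ = f @^-1` [set a | a != 0]) //.
apply: open_comp => [x _|]; [exact: cf|exact: open_neq].
Qed.

Variable E : bundle M.
Implicit Types (X Y : sec E) (f g : M -> R).

Lemma smooth_secD X Y : smooth_sec X -> smooth_sec Y -> smooth_sec (secD X Y).
Proof.
move=> sX sY e fe i; apply: (@smooth_on_eq _ _ _
  (fun x => coord (fvec e x) i (X x) + coord (fvec e x) i (Y x))).
- exact: (b_open fe).
- by move=> x _; rewrite /secD linearD.
- by apply: smooth_onD; [exact: (b_open fe)|exact: sX|exact: sY].
Qed.

Lemma smooth_secZ f X : smooth f -> smooth_sec X -> smooth_sec (secZ f X).
Proof.
move=> sf sX e fe i; apply: (@smooth_on_eq _ _ _
  (fun x => f x * coord (fvec e x) i (X x))).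
- exact: (b_open fe).
- by move=> x _; rewrite /secZ linearZ.
- apply: smooth_onM; [exact: (b_open fe)| |exact: sX].
  by apply: smooth_on_sub sf.
Qed.

Lemma smooth_sec0 : smooth_sec (@sec0 R M E).
Proof.
move=> e fe i; apply: (@smooth_on_eq _ _ _ (fun=> 0)).
- exact: (b_open fe).
- by move=> x _; rewrite /sec0 linear0.
- exact: smooth_on_cst.
Qed.

Lemma smooth_sec_sum (I : Type) (r : seq I) (X : I -> sec E) :
  (forall i, smooth_sec (X i)) -> smooth_sec (fun x => \sum_(i <- r) X i x).
Proof.
move=> sX; elim: r => [|i r IH].
  rewrite (_ : (fun x => _) = @sec0 R M E); first exact: smooth_sec0.
  by apply: functional_extensionality_dep => x; rewrite big_nil.
rewrite (_ : (fun x => _) = secD (X i) (fun x => \sum_(i <- r) X i x)).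
  exact: smooth_secD.
by apply: functional_extensionality_dep => x; rewrite big_cons.
Qed.

(** Near x the factor f is invertible and can be divided out of the coordinates. *)
Lemma smooth_sec_local X :
  (forall x, exists f, [/\ smooth f, f x = 1 & smooth_sec (secZ f X)]) ->
  smooth_sec X.
Proof.
move=> h e fe i; apply: smooth_on_local => x ex.
have [f [sf fx sfX]] := h x.
have oe : open (fdom e) := b_open fe.
exists (fdom e `&` [set y | f y != 0]); first by split => //=; rewrite fx oner_neq0.
apply: (@smooth_on_eq _ _ _
  (fun y => (f y)^-1 * coord (fvec e y) i (secZ f X y))).
- by apply: openI => //; exact: open_neq0.
- by move=> y [_ /= fy]; rewrite /secZ linearZ /= mulKf.
- apply: smooth_onM.
  + by apply: openI => //; exact: open_neq0.
  + apply: smooth_onV; [by apply: openI => //; exact: open_neq0| |].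
      by move=> y [].
    by apply: smooth_on_sub sf.
  + by apply: smooth_on_sub (sfX e fe i) => y [].
Qed.

(** The cut-off frame vectors are smooth on [fdom e] by compatibility of the frames and vanish off a
    closed K inside it; [fdom e] and the complement of K cover M. *)
Lemma bump_frame (e : frame E (rank E)) x : frames e -> fdom e x ->
  exists g (K : set M), [/\ smooth g, K `<=` fdom e, g x = 1,
    (forall y, ~ K y -> g y = 0) &
    forall i, smooth_sec (secZ g (fun y => tnth (fvec e y) i))].
Proof.
move=> fe ex; have oe : open (fdom e) := b_open fe.
have [g [K [sg cK Ke gx gK]]] := bump_exists oe ex.
exists g, K; split => // i e' fe' j; apply: smooth_on_local => y e'y.
have oe' : open (fdom e') := b_open fe'.
have [Ky|nKy] := pselect (K y).
  exists (fdom e `&` fdom e'); first by split => //; exact: Ke.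
  apply: (@smooth_on_eq _ _ _
    (fun y => g y * coord (fvec e' y) j (tnth (fvec e y) i))).
  - exact: openI.
  - by move=> z _; rewrite /secZ linearZ.
  - apply: smooth_onM; [exact: openI|exact: smooth_on_sub sg|].
    exact: b_compat.
exists (~` K) => //; apply: (@smooth_on_eq _ _ _ (fun=> 0)).
- exact: closed_openC.
- by move=> z /gK gz; rewrite /secZ gz scale0r linear0.
- exact: smooth_on_cst.
Qed.

End Sections.

(* The pairings between A and its dual, in either order.  Global sections E_i,
   F_i that are dual frames up to the factor h, with h = 1 at x, replace the
   local dual frames. *)
Record dual_pairing (R : realType) (M : manifold R) (A B : bundle M)
    (p : forall x, A x -> B x -> R) : Prop := DualPairing {
  pairing_linear_l : forall x a u v l, p x (a *: u + v) l = a * p x u l + p x v l;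
  pairing_linear_r : forall x a u l m, p x u (a *: l + m) = a * p x u l + p x u m;
  pairing_smooth : forall X Y, smooth_sec X -> smooth_sec Y ->
    smooth (fun x => p x (X x) (Y x));
  pairing_frames : forall x, exists n (E : 'I_n -> sec A) (F : 'I_n -> sec B) h,
    [/\ smooth h /\ h x = 1, forall i, smooth_sec (E i),
        forall i, smooth_sec (F i),
        forall y u, h y *: u = \sum_i p y u (F i y) *: E i y &
        forall y l, h y *: l = \sum_i p y (E i y) l *: F i y] }.

Lemma dual_pairing_sym (R : realType) (M : manifold R) (A B : bundle M)
    (p : forall x, A x -> B x -> R) :
  dual_pairing p -> dual_pairing (fun x b a => p x a b).
Proof.
case=> ll lr sm fr; split => //; first by move=> X Y sX sY; exact: sm.
by move=> x; have [n [E [F [h [*]]]]] := fr x; exists n, F, E, h.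
Qed.

Section DualBundle.
Variables (R : realType) (M : manifold R) (A : bundle M).

Lemma ev_frame_expansion (e : frame A (rank A)) x (u : A x) (l : dual A x) :
  frames e -> fdom e x ->
  ev u l = \sum_i coord (fvec e x) i u * coord (fvec (dual_frame e) x) i l.
Proof.
move=> fe ex; rewrite /ev {1}(coord_basis (b_basis fe ex) (memvf u)) linear_sum.
apply: eq_bigr => i _; rewrite linearZ /= coord_dual_frame//.
by rewrite (tnth_nth 0).
Qed.

Lemma ev_smooth (X : sec A) (Y : sec (dual A)) :
  smooth_sec X -> smooth_sec Y -> smooth (fun x => ev (X x) (Y x)).
Proof.
move=> sX sY; apply: smooth_on_local => x _.
have [e fe ex] := b_cover A x; exists (fdom e) => //.
have oe : open (fdom e) := b_open fe.
have de : @frames R M (dual A) (dual_frame e) by exists e.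
apply: (@smooth_on_eq _ _ _ (fun x => \sum_i coord (fvec e x) i (X x) *
  coord (fvec (dual_frame e) x) i (Y x))) => //.
  by move=> y ey; rewrite (ev_frame_expansion _ _ fe).
apply: smooth_on_sum => // i _; apply: smooth_onM => //; first exact: sX.
exact: (sY _ de).
Qed.

Lemma ev_dual_pairing : dual_pairing (@ev R M A).
Proof.
split.
- by move=> x a u v l; rewrite /ev linearP.
- by move=> x a u l m; rewrite /ev add_lfunE scale_lfunE.
- exact: ev_smooth.
move=> x; have [e fe ex] := b_cover A x.
have de : @frames R M (dual A) (dual_frame e) by exists e.
have [g [K [sg Ke gx gK sE]]] := bump_frame fe ex.
have [g' [K' [sg' Ke' gx' gK' sF]]] := bump_frame de ex.
(* The frame and its dual are cut off separately, by g and g', so their product is the factor in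
   both expansions. *)
exists (rank A), (fun i => secZ g (fun y => tnth (fvec e y) i)),
  (fun i => @secZ R M (dual A) g' (fun y => tnth (fvec (dual_frame e) y) i)),
  (fun y => g' y * g y); split => //.
- by split; [exact: smoothM|rewrite gx gx' mulr1].
- move=> y u; have [Ky|nKy] := pselect (K y); last first.
    rewrite gK// mulr0 scale0r big1// => i _.
    by rewrite /secZ gK// scale0r scaler0.
  have be := b_basis fe (Ke _ Ky).
  rewrite {1}(coord_basis be (memvf u)) scaler_sumr; apply: eq_bigr => i _.
  rewrite /secZ /ev scale_lfunE !scalerA tnth_mktuple lfunE /= (tnth_nth 0).
  by congr (_ *: _); rewrite /GRing.scale /=; ring.
- move=> y l; have [Ky|nKy] := pselect (K y); last first.
    rewrite gK// mulr0 scale0r big1// => i _.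
    by rewrite /secZ gK// scale0r /ev linear0 scale0r.
  have bd := dual_frame_basis fe (Ke _ Ky).
  rewrite {1}(coord_basis bd (memvf l)) scaler_sumr; apply: eq_bigr => i _.
  rewrite coord_dual_frame//; last exact: Ke.
  have evZ a u : ev (a *: u) l = a * ev u l by rewrite /ev linearZ.
  rewrite scalerA /secZ evZ scalerA (tnth_nth 0 (fvec (dual_frame e) y)).
  by congr (_ *: _); rewrite /ev; ring.
Qed.

End DualBundle.

Lemma sec_ext (R : realType) (M : manifold R) (E : bundle M) (X Y : sec E) :
  (forall x, X x = Y x) -> X = Y.
Proof. exact: functional_extensionality_dep. Qed.

(** * Derivations and anchors *)

Section Tangent.
Variables (R : realType) (M : manifold R) (x : M) (D : (M -> R) -> R).
Hypothesis tD : is_tangent x D.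
Implicit Types (f g : M -> R).

Lemma tangentD f g : smooth f -> smooth g -> D (fun y => f y + g y) = D f + D g.
Proof.
move=> sf sg; have := tD.1 1 f g sf sg; rewrite mul1r => <-.
by congr D; apply/funext => y; rewrite mul1r.
Qed.

Lemma tangentM f g : smooth f -> smooth g ->
  D (fun y => f y * g y) = f x * D g + g x * D f.
Proof. exact: tD.2. Qed.

Lemma tangent_cst (a : R) : D (fun=> a) = 0.
Proof.
have h1 : D (fun=> 1) = 0.
  have := tangentM (@smooth_cst R M 1) (@smooth_cst R M 1).
  rewrite (_ : (fun _ : M => _) = fun=> 1); last by apply/funext => y; rewrite mul1r.
  by move=> h; lra.
have h0 : D (fun=> 0) = 0.
  have := tangentD (@smooth_cst R M 0) (@smooth_cst R M 0).
  rewrite (_ : (fun _ : M => _) = fun=> 0); last by apply/funext => y; rewrite addr0.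
  by move=> h; lra.
have <- : D (fun y => a * (fun=> 1) y + (fun=> 0) y) = 0.
  by rewrite tD.1 ?h1 ?h0; [ring|exact: smooth_cst..].
by congr D; apply/funext => y; rewrite mulr1 addr0.
Qed.

Lemma tangentN f : smooth f -> D (fun y => - f y) = - D f.
Proof.
move=> sf; rewrite (_ : (fun y => _) = fun y => -1 * f y).
  by rewrite tangentM ?tangent_cst; [ring|exact: smooth_cst|].
by apply/funext => y; rewrite mulN1r.
Qed.

End Tangent.

Section Anchor.
Variables (R : realType) (M : manifold R) (E : bundle M) (L : lie_algebroid E).
Implicit Types (f g : M -> R) (X Y Z : sec E).

Section AtPoint.
Variables (x : M) (u : E x).

Lemma anchorD f g : smooth f -> smooth g ->
  anchor L u (fun y => f y + g y) = anchor L u f + anchor L u g.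
Proof. exact: (tangentD (anchor_tangent L u)). Qed.

Lemma anchorM f g : smooth f -> smooth g ->
  anchor L u (fun y => f y * g y) = f x * anchor L u g + g x * anchor L u f.
Proof. exact: (tangentM (anchor_tangent L u)). Qed.

Lemma anchor_cst (a : R) : anchor L u (fun=> a) = 0.
Proof. exact: (tangent_cst (anchor_tangent L u)). Qed.

Lemma anchorN f : smooth f -> anchor L u (fun y => - f y) = - anchor L u f.
Proof. exact: (tangentN (anchor_tangent L u)). Qed.

Lemma anchorB f g : smooth f -> smooth g ->
  anchor L u (fun y => f y - g y) = anchor L u f - anchor L u g.
Proof. by move=> sf sg; rewrite anchorD ?anchorN//; exact: smoothN. Qed.

Variable v : E x.

Lemma anchorDl f : smooth f -> anchor L (u + v) f = anchor L u f + anchor L v f.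
Proof.
by move=> sf; have := anchor_linear L 1 u v sf; rewrite scale1r mul1r.
Qed.

Lemma anchor0l f : smooth f -> anchor L (0 : E x) f = 0.
Proof.
move=> sf; have := anchor_linear L 1 (0 : E x) 0 sf.
rewrite scaler0 addr0 => h; lra.
Qed.

Lemma anchorZl (a : R) f : smooth f -> anchor L (a *: u) f = a * anchor L u f.
Proof.
by move=> sf; have := anchor_linear L a u 0 sf; rewrite anchor0l// !addr0.
Qed.

End AtPoint.

Lemma secZN1 X x : secZ (fun=> -1) X x = - X x.
Proof. by rewrite /secZ scaleN1r. Qed.

Lemma bracketC X Y x : smooth_sec X -> smooth_sec Y ->
  bracket L X Y x = - bracket L Y X x.
Proof. by move=> sX sY; rewrite bracket_skew// secZN1. Qed.

Lemma bracketDl X Y Z x : smooth_sec X -> smooth_sec Y -> smooth_sec Z ->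
  bracket L (secD X Y) Z x = bracket L X Z x + bracket L Y Z x.
Proof.
move=> sX sY sZ; have := bracket_linear L 1 sX sY sZ.
rewrite (_ : secZ _ X = X); last by apply: sec_ext => y; rewrite /secZ scale1r.
by move=> ->; rewrite /secD /secZ scale1r.
Qed.

Lemma bracketDr X Y Z x : smooth_sec X -> smooth_sec Y -> smooth_sec Z ->
  bracket L X (secD Y Z) x = bracket L X Y x + bracket L X Z x.
Proof.
move=> sX sY sZ; rewrite bracketC//; last exact: smooth_secD.
by rewrite bracketDl// opprD -!bracketC.
Qed.

Lemma bracketZr X f Y x : smooth_sec X -> smooth f -> smooth_sec Y ->
  bracket L X (secZ f Y) x = f x *: bracket L X Y x + anchor L (X x) f *: Y x.
Proof. by move=> sX sf sY; rewrite bracket_leibniz. Qed.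

Lemma bracketZl X f Y x : smooth_sec X -> smooth f -> smooth_sec Y ->
  bracket L (secZ f X) Y x = f x *: bracket L X Y x - anchor L (Y x) f *: X x.
Proof.
move=> sX sf sY; rewrite bracketC//; last exact: smooth_secZ.
by rewrite bracketZr// opprD -scalerN -bracketC.
Qed.

End Anchor.

(** * Tensorial functionals of sections *)

Section Pairing.
Variables (R : realType) (M : manifold R) (A B : bundle M).
Variables (p : forall x, A x -> B x -> R) (dp : dual_pairing p).
Implicit Types (X Y : sec A) (al be : sec B) (f g : M -> R).

Lemma pairingDl x u v l : p (x := x) (u + v) l = p u l + p v l.
Proof. by rewrite -[u]scale1r (pairing_linear_l dp) mul1r scale1r. Qed.

Lemma pairingDr x u l m : p (x := x) u (l + m) = p u l + p u m.
Proof. by rewrite -[l]scale1r (pairing_linear_r dp) mul1r scale1r. Qed.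

Lemma pairing0l x l : p (x := x) 0 l = 0.
Proof. by apply: (@addIr _ (p (x := x) 0 l)); rewrite -pairingDl !add0r. Qed.

Lemma pairing0r x u : p (x := x) u 0 = 0.
Proof. by apply: (@addIr _ (p (x := x) u 0)); rewrite -pairingDr !add0r. Qed.

Lemma pairingZl x a u l : p (x := x) (a *: u) l = a * p u l.
Proof. by rewrite -[a *: u]addr0 (pairing_linear_l dp) pairing0l addr0. Qed.

Lemma pairingZr x a u l : p (x := x) u (a *: l) = a * p u l.
Proof. by rewrite -[a *: l]addr0 (pairing_linear_r dp) pairing0r addr0. Qed.

Lemma pairingNl x u l : p (x := x) (- u) l = - p u l.
Proof. by rewrite -scaleN1r pairingZl mulN1r. Qed.

Lemma pairingNr x u l : p (x := x) u (- l) = - p u l.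
Proof. by rewrite -scaleN1r pairingZr mulN1r. Qed.

Lemma pairing_suml x (I : Type) (r : seq I) (F : I -> A x) l :
  p (\sum_(i <- r) F i) l = \sum_(i <- r) p (F i) l.
Proof.
elim: r => [|i r IH]; first by rewrite !big_nil pairing0l.
by rewrite !big_cons pairingDl IH.
Qed.

Lemma pairing_nondegenerate x (u v : A x) : (forall l, p u l = p v l) -> u = v.
Proof.
move=> h; have [n [E [F [f [[_ fx] _ _ ex _]]]]] := pairing_frames dp x.
rewrite -[u]scale1r -[v]scale1r -fx !ex; apply: eq_bigr => i _.
by rewrite h.
Qed.

Lemma sec_through_exists x (u : A x) : exists X, smooth_sec X /\ X x = u.
Proof.
have [n [E [F [f [[_ fx] sE _ ex _]]]]] := pairing_frames dp x.
exists (fun y => \sum_i secZ (fun=> p u (F i x)) (E i) y); split.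
  by apply: smooth_sec_sum => i; apply: smooth_secZ; [exact: smooth_cst|exact: sE].
by rewrite -[RHS]scale1r -fx ex.
Qed.

Lemma sec_throughP x (u : A x) : smooth_sec (sec_through u) /\ sec_through u x = u.
Proof.
rewrite /sec_through; case: pselect => [h|]; last by case; exact: sec_through_exists.
by case: (cid h).
Qed.

Section Tensorial.
Variables (x : M) (T : sec A -> R).
Hypothesis TD : forall X Y, smooth_sec X -> smooth_sec Y -> T (secD X Y) = T X + T Y.
Hypothesis TZ : forall f X, smooth f -> smooth_sec X -> T (secZ f X) = f x * T X.

Lemma tensorial0 : T (@sec0 R M A) = 0.
Proof.
have := TZ (@smooth_cst R M 0) (@smooth_sec0 R M A); rewrite mul0r => <-.
by congr T; apply: sec_ext => y; rewrite /secZ scale0r.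
Qed.

Lemma tensorial_sum (I : Type) (r : seq I) (F : I -> M -> R) (E : I -> sec A) :
  (forall i, smooth (F i)) -> (forall i, smooth_sec (E i)) ->
  T (fun y => \sum_(i <- r) F i y *: E i y) = \sum_(i <- r) F i x * T (E i).
Proof.
move=> sF sE; elim: r => [|i r IH].
  rewrite big_nil -[RHS]tensorial0; congr T.
  by apply: sec_ext => y; rewrite big_nil.
rewrite big_cons -TZ// -IH -TD; last 2 first.
- exact: smooth_secZ.
- by apply: (@smooth_sec_sum _ _ _ _ _ (fun i => secZ (F i) (E i))) => j;
    exact: smooth_secZ.
by congr T; apply: sec_ext => y; rewrite big_cons.
Qed.

(** Multiplied by f, with f x = 1, the section X becomes a global combination of the E_i whose
    coefficients vanish at x. *)
Lemma tensorial_vanish X : smooth_sec X -> X x = 0 -> T X = 0.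
Proof.
move=> sX X0; have [n [E [F [f [[sf fx] sE sF ex _]]]]] := pairing_frames dp x.
rewrite -[T X]mul1r -fx -TZ// (_ : secZ f X =
    fun y => \sum_i p (X y) (F i y) *: E i y); last by apply: sec_ext => y; exact: ex.
rewrite tensorial_sum//; last by move=> i; exact: (pairing_smooth dp).
by rewrite big1// => i _; rewrite X0 pairing0l mul0r.
Qed.

Lemma tensorial_eq X Y : smooth_sec X -> smooth_sec Y -> X x = Y x -> T X = T Y.
Proof.
move=> sX sY XY; have sNY : smooth_sec (secZ (fun=> -1) Y).
  by apply: smooth_secZ => //; exact: smooth_cst.
have : T (secD X (secZ (fun=> -1) Y)) = 0.
  by apply: tensorial_vanish; [exact: smooth_secD|rewrite /secD secZN1 XY subrr].
rewrite TD// TZ//; last exact: smooth_cst.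
by rewrite mulN1r => /eqP; rewrite subr_eq0 => /eqP.
Qed.

End Tensorial.
End Pairing.

(** * Sections of B from function-linear functionals on sections of A *)

Section Represent.
Variables (R : realType) (M : manifold R) (A B : bundle M).
Variables (p : forall x, A x -> B x -> R) (dp : dual_pairing p).
Implicit Types (X Y : sec A) (al be : sec B) (f g : M -> R).

Definition represents (T : sec A -> M -> R) al := smooth_sec al /\
  forall X, smooth_sec X -> forall x, p (X x) (al x) = T X x.

(** At x the value is the sum of T(E_i)(x) F_i(x); its pairing with X x is T X x whichever frames
    are used. Near x, f times the section so chosen is a global combination of the F_i with smooth
    coefficients, which gives smoothness. *)
Lemma represent (T : sec A -> M -> R) :
  (forall X, smooth_sec X -> smooth (T X)) ->
  (forall X Y x, smooth_sec X -> smooth_sec Y -> T (secD X Y) x = T X x + T Y x) ->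
  (forall f X x, smooth f -> smooth_sec X -> T (secZ f X) x = f x * T X x) ->
  exists al, represents T al.
Proof.
move=> sT TD TZ.
have Tx x X : smooth_sec X -> forall n (E : 'I_n -> sec A) (F : 'I_n -> sec B) f,
    smooth f -> (forall i, smooth_sec (E i)) -> (forall i, smooth_sec (F i)) ->
    (forall y u, f y *: u = \sum_i p u (F i y) *: E i y) ->
    f x * T X x = \sum_i p (X x) (F i x) * T (E i) x.
  move=> sX n E F f sf sE sF ex; rewrite -TZ//.
  rewrite (_ : secZ f X = fun y => \sum_i p (X y) (F i y) *: E i y); last first.
    by apply: sec_ext => y; exact: ex.
  apply: (@tensorial_sum _ _ _ x (fun X => T X x)) => //.
  - by move=> *; exact: TD.
  - by move=> *; exact: TZ.
  - by move=> i; exact: (pairing_smooth dp).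
have al_at x : exists l : B x, forall X, smooth_sec X -> p (X x) l = T X x.
  have [n [E [F [f [[sf fx] sE sF ex _]]]]] := pairing_frames dp x.
  exists (\sum_i T (E i) x *: F i x) => X sX.
  rewrite (pairing_suml (dual_pairing_sym dp)) -[RHS]mul1r -fx (Tx x X sX n E F)//.
  by apply: eq_bigr => i _; rewrite (pairingZr dp) mulrC.
pose al : sec B := fun x => sval (cid (al_at x)).
have alP X x : smooth_sec X -> p (X x) (al x) = T X x.
  by move=> sX; rewrite /al; case: cid => l /= ->.
exists al; split; last by move=> X sX x; exact: alP.
apply: smooth_sec_local => x.
have [n [E [F [f [[sf fx] sE sF _ ex]]]]] := pairing_frames dp x.
exists f; split => //; rewrite (_ : secZ f al = fun y => \sum_i secZ (T (E i)) (F i) y).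
  by apply: smooth_sec_sum => i; apply: smooth_secZ => //; exact: sT.
by apply: sec_ext => y; rewrite [LHS]ex; apply: eq_bigr => i _; rewrite alP.
Qed.

(** Totalised by choice with default zero, so that gradients and Lie derivatives are sections for
    arbitrary arguments. *)
Definition representative (T : sec A -> M -> R) : sec B :=
  if pselect (exists al, represents T al) is left h then sval (cid h)
  else @sec0 R M B.

Lemma representativeP T : (exists al, represents T al) ->
  represents T (representative T).
Proof. by rewrite /representative; case: pselect => // h _; case: (cid h). Qed.

Variable L : lie_algebroid A.

(** The differential df as a section of B rather than a cochain, so that the anchor and the bracket
    of the other algebroid apply to it; likewise for L_X al below. *)
Definition gradient f : sec B := representative (fun X x => anchor L (X x) f).

Definition lie_derivative X al : sec B := representative (fun Y x =>
  anchor L (X x) (fun y => p (Y y) (al y)) - p (bracket L X Y x) (al x)).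

Lemma gradientP f : smooth f -> represents (fun X x => anchor L (X x) f) (gradient f).
Proof.
move=> sf; apply: representativeP; apply: represent.
- by move=> X sX; exact: anchor_smooth.
- by move=> X Y x sX sY; exact: anchorDl.
- by move=> g X x sg sX; exact: anchorZl.
Qed.

Lemma lie_derivativeP X al : smooth_sec X -> smooth_sec al ->
  represents (fun Y x =>
    anchor L (X x) (fun y => p (Y y) (al y)) - p (bracket L X Y x) (al x))
    (lie_derivative X al).
Proof.
move=> sX sal; apply: representativeP; apply: represent.
- move=> Y sY; apply: smoothB; last first.
    by apply: (pairing_smooth dp) => //; exact: bracket_smooth.
  by apply: anchor_smooth => //; exact: (pairing_smooth dp).
- move=> Y Z x sY sZ; rewrite bracketDr// (pairingDl dp).
  rewrite (_ : (fun y => _) = fun y => p (Y y) (al y) + p (Z y) (al y)); last first.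
    by apply/funext => y; rewrite /secD (pairingDl dp).
  rewrite anchorD; [ring|exact: (pairing_smooth dp)..].
- move=> f Y x sf sY; rewrite bracketZr// (pairingDl dp) !(pairingZl dp).
  rewrite (_ : (fun y => _) = fun y => f y * p (Y y) (al y)); last first.
    by apply/funext => y; rewrite /secZ (pairingZl dp).
  rewrite anchorM//; [ring|exact: (pairing_smooth dp)].
Qed.

End Represent.

(** * Alternating forms *)

Section Multilinear.
Variables (R : realType).

Section Wedge.
Variable T : Type.
Implicit Types (a : T -> R) (w : seq T -> R) (s : seq T).

(** The recursion is i_v (a /\ w) = a(v) w - a /\ i_v w. T is any type because the formula serves
    both for vectors at a point and for lists of sections, on which w need not be tensorial. *)
Fixpoint wedge1 a w s : R :=
  if s is v :: s' then a v * w s' - wedge1 a (fun t => w (v :: t)) s' else 0.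

Lemma wedge1D a w1 w2 s :
  wedge1 a (fun t => w1 t + w2 t) s = wedge1 a w1 s + wedge1 a w2 s.
Proof.
elim: s w1 w2 => [|v s IH] w1 w2 /=; first by rewrite addr0.
by rewrite IH; ring.
Qed.

Lemma wedge1Z a c w s : wedge1 a (fun t => c * w t) s = c * wedge1 a w s.
Proof.
elim: s w => [|v s IH] w /=; first by rewrite mulr0.
by rewrite IH; ring.
Qed.

(** The offset j counts the slots already filled, since the recursion contracts w once at each
    step. *)
Lemma wedge1_degree a w s j k :
  (forall t, (j + size t != k)%N -> w t = 0) -> (j + size s != k.+1)%N ->
  wedge1 a w s = 0.
Proof.
elim: s w j => [|v s IH] w j w0 //=; rewrite addnS eqSS => js.
rewrite w0// (IH _ j.+1) ?mulr0 ?subr0 ?addSn ?eqSS// => t jt.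
by apply: w0; rewrite /= addnS -addSn.
Qed.

Definition wedge_at w1 w2 s : R := \sum_(m : (size s).-tuple bool)
  (-1) ^+ inversions m * w1 (mask m s) * w2 (mask (map negb m) s).

(** A leading false is inverted with every later true; a leading true creates no inversion. *)
Lemma inversions_cons (b : bool) (m : bitseq) :
  inversions (b :: m) = (inversions m + ~~ b * count id m)%N.
Proof.
rewrite /inversions /= big_ord_recl big_ord0 add0n.
rewrite [LHS](eq_bigr (fun j : 'I_(size m) =>
  (nth false m j && ~~ b) +
  \sum_(i < j) (nth false m j && ~~ nth false m i))%N); last first.
  by move=> j _; rewrite lift0 big_ord_recl.
rewrite big_split addnC; congr addn.
have -> : count id m = (\sum_(j < size m) nth false m j)%N.
  elim: m => [|c m IH] /=; first by rewrite big_ord0.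
  by rewrite big_ord_recl /= IH.
by rewrite big_distrr; apply: eq_bigr => j _ /=; case: (nth _ _ _); case: b.
Qed.

Lemma big_tuple_bool n (F : n.+1.-tuple bool -> R) :
  \sum_m F m = \sum_(m : n.-tuple bool) F [tuple of true :: m] +
               \sum_(m : n.-tuple bool) F [tuple of false :: m].
Proof.
rewrite (reindex (fun bm : bool * n.-tuple bool => [tuple of bm.1 :: bm.2])) /=.
  rewrite -(pair_bigA _ (fun (b : bool) (m : n.-tuple bool) => F [tuple of b :: m])).
  by rewrite /= big_bool.
exists (fun m => (thead m, [tuple of behead m])) => [[b m] _|m _] /=.
  by congr pair; apply: val_inj.
by rewrite [RHS]tuple_eta; apply: val_inj.
Qed.

(** The first vector goes either to w1 or to w2; in the second case it passes all arguments of w1,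
    whence the sign. *)
Lemma wedge_at_cons w1 w2 v s : wedge_at w1 w2 (v :: s) =
  wedge_at (fun t => w1 (v :: t)) w2 s +
  wedge_at (fun t => (-1) ^+ size t * w1 t) (fun t => w2 (v :: t)) s.
Proof.
rewrite /wedge_at big_tuple_bool /=; congr (_ + _); apply: eq_bigr => m _.
  by rewrite inversions_cons mul0n addn0.
rewrite inversions_cons mul1n exprD size_mask ?size_tuple//.
by congr (_ * _); ring.
Qed.

Lemma wedge_at_ext w1 w1' w2 s : (forall t, w1 t = w1' t) ->
  wedge_at w1 w2 s = wedge_at w1' w2 s.
Proof. by move=> h; apply: eq_bigr => m _; rewrite h. Qed.

Lemma wedge_at_nil w1 w2 : wedge_at w1 w2 [::] = w1 [::] * w2 [::].
Proof.
rewrite /wedge_at (eq_bigr (fun=> w1 [::] * w2 [::])); last first.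
  by move=> m _; rewrite tuple0 /= /inversions big_ord0 expr0 mul1r.
by rewrite sumr_const card_tuple card_bool expn0.
Qed.

Lemma wedge_at_scalar c w s :
  wedge_at (fun t => if t is [::] then c else 0) w s = c * w s.
Proof.
elim: s w => [|v s IH] w; first by rewrite wedge_at_nil.
rewrite wedge_at_cons [X in X + _]big1 ?add0r; last by move=> m _; rewrite mulr0 mul0r.
rewrite -[RHS](IH (fun t => w (v :: t))); apply: wedge_at_ext => -[|u t] /=.
  by rewrite mul1r.
by rewrite mulr0.
Qed.

Lemma wedge_at_linear a w s :
  wedge_at (fun t => if t is [:: v] then a v else 0) w s = wedge1 a w s.
Proof.
elim: s w => [|v s IH] w; first by rewrite wedge_at_nil mul0r.
rewrite wedge_at_cons /= -IH -wedge_at_scalar; congr (_ + _).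
rewrite /wedge_at -sumrN; apply: eq_bigr => m _.
set t := mask m s; case: t => [|u [|u' t]]; rewrite ?mulr0 ?mul0r ?oppr0//.
by rewrite expr1; ring.
Qed.

End Wedge.

Lemma wedge1_map (T U : Type) (h : T -> U) a w s :
  wedge1 a w (map h s) = wedge1 (fun v => a (h v)) (fun t => w (map h t)) s.
Proof. by elim: s w => [|v s IH] w //=; rewrite IH. Qed.

Section Alternating.
Variable V : lmodType R.
Implicit Types (w : seq V -> R) (s t : seq V) (u v : V).

Definition linear_slots w := forall s t a u v,
  w (s ++ (a *: u + v) :: t) = a * w (s ++ u :: t) + w (s ++ v :: t).

Definition alternating w := forall s1 s2 s3 u,
  w (s1 ++ u :: s2 ++ u :: s3) = 0.

Definition multilinear w := linear_slots w /\ alternating w.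

Lemma multilinear_contract w v : multilinear w -> multilinear (fun s => w (v :: s)).
Proof.
case=> lin alt; split=> [s t|s1 s2 s3 u]; first exact: (lin (v :: s) t).
exact: (alt (v :: s1)).
Qed.

Section Head.
Variable w : seq V -> R.
Hypothesis mw : multilinear w.

Lemma form_headD u v t : w (u + v :: t) = w (u :: t) + w (v :: t).
Proof. by have := mw.1 [::] t 1 u v; rewrite scale1r mul1r. Qed.

Lemma form_head0 t : w (0 :: t) = 0.
Proof. by apply: (@addIr _ (w (0 :: t))); rewrite -form_headD !add0r. Qed.

Lemma form_headZ a u t : w (a *: u :: t) = a * w (u :: t).
Proof. by have := mw.1 [::] t a u 0; rewrite /= addr0 form_head0 addr0. Qed.

Lemma form_headN u t : w (- u :: t) = - w (u :: t).
Proof. by rewrite -scaleN1r form_headZ mulN1r. Qed.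

Lemma form_head_sum (I : Type) (r : seq I) (F : I -> V) t :
  w (\sum_(i <- r) F i :: t) = \sum_(i <- r) w (F i :: t).
Proof.
elim: r => [|i r IH]; first by rewrite !big_nil form_head0.
by rewrite !big_cons form_headD IH.
Qed.

End Head.

Lemma form_slot_sum w s (I : Type) (r : seq I) (F : I -> V) t : multilinear w ->
  w (s ++ \sum_(i <- r) F i :: t) = \sum_(i <- r) w (s ++ F i :: t).
Proof.
elim: s w => [|v s IH] w mw; first exact: form_head_sum.
exact: (IH (fun t => w (v :: t)) (multilinear_contract v mw)).
Qed.

Lemma form_slotZ w s a u t : multilinear w -> w (s ++ a *: u :: t) = a * w (s ++ u :: t).
Proof.
elim: s w => [|v s IH] w mw; first exact: form_headZ.
exact: (IH (fun t => w (v :: t)) (multilinear_contract v mw)).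
Qed.

Lemma form_swap w u v t : multilinear w -> w (u :: v :: t) = - w (v :: u :: t).
Proof.
move=> mw; have := mw.2 [::] [::] t (u + v); rewrite /= form_headD//.
have mu := multilinear_contract u mw; have mv := multilinear_contract v mw.
rewrite (form_headD mu) (form_headD mv).
rewrite (mw.2 [::] [::] t u) (mw.2 [::] [::] t v) /= add0r addr0.
by move/eqP; rewrite addr_eq0 => /eqP.
Qed.

Lemma multilinearD w1 w2 : multilinear w1 -> multilinear w2 ->
  multilinear (fun s => w1 s + w2 s).
Proof.
move=> [l1 a1] [l2 a2]; split=> [s t a u v|s1 s2 s3 u].
  by rewrite l1 l2; ring.
by rewrite a1 a2 addr0.
Qed.

Lemma multilinearZ c w : multilinear w -> multilinear (fun s => c * w s).
Proof.
move=> [l1 a1]; split=> [s t a u v|s1 s2 s3 u]; last by rewrite a1 mulr0.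
by rewrite l1; ring.
Qed.

(** Terms that feed u to the form already contracted with u vanish by alternation. Only the term
    with a(u) survives, and its shuffle sign is undone by moving u back across s. *)
Lemma wedge1_contract a w u s t : multilinear w ->
  wedge1 a (fun s => w (u :: s)) (s ++ u :: t) = a u * w (s ++ u :: t).
Proof.
elim: s w => [|v s IH] w mw /=.
  have -> : (fun t => w (u :: u :: t)) = fun t => 0 * w t.
    by apply/funext => r; rewrite mul0r; exact: (mw.2 [::] [::] r u).
  by rewrite wedge1Z; ring.
have -> : (fun t => w (u :: v :: t)) = fun t => -1 * w (v :: u :: t).
  by apply/funext => r; rewrite mulN1r form_swap.
rewrite wedge1Z (IH _ (multilinear_contract v mw)).
by rewrite (mw.2 [::] s t u); ring.
Qed.

Lemma wedge1_multilinear a w :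
  (forall c u v, a (c *: u + v) = c * a u + a v) -> multilinear w ->
  multilinear (wedge1 a w).
Proof.
move=> la mw; split=> [s|s1].
  elim: s w mw => [|x s IH] w mw t c u v /=.
    have -> : (fun t => w (c *: u + v :: t)) = fun t => c * w (u :: t) + w (v :: t).
      by apply/funext => r; exact: (mw.1 [::] r).
    by rewrite (wedge1D _ (fun t => c * w (u :: t))) wedge1Z la; ring.
  by rewrite mw.1 (IH _ (multilinear_contract x mw)); ring.
elim: s1 w mw => [|x s IH] w mw s2 s3 u /=; last first.
  by rewrite mw.2 (IH _ (multilinear_contract x mw)); ring.
by rewrite wedge1_contract// subrr.
Qed.

(* Euler's identity sum_i E_i /\ i_{F_i} w = k w on k-forms, for E_i, F_i dual
   up to the factor h. *)
Lemma wedge1_euler n (F : 'I_n -> V) (E : 'I_n -> V -> R) h w s :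
  (forall u, h *: u = \sum_i E i u *: F i) -> multilinear w ->
  \sum_i wedge1 (E i) (fun t => w (F i :: t)) s = (size s)%:R * h * w s.
Proof.
move=> ex; elim: s w => [|v s IH] w mw; first by rewrite big1// !mul0r.
rewrite /= sumrB.
have -> : \sum_i E i v * w (F i :: s) = h * w (v :: s).
  rewrite -form_headZ// ex form_head_sum//; apply: eq_bigr => i _.
  by rewrite form_headZ.
have -> : \sum_i wedge1 (E i) (fun t => w [:: F i, v & t]) s =
    - \sum_i wedge1 (E i) (fun t => w [:: v, F i & t]) s.
  rewrite -sumrN; apply: eq_bigr => i _; rewrite -mulN1r -wedge1Z; congr wedge1.
  by apply/funext => t; rewrite mulN1r form_swap.
rewrite (IH (fun t => w (v :: t)) (multilinear_contract v mw)).
by rewrite -addn1 natrD; ring.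
Qed.

End Alternating.
End Multilinear.

Lemma cochain_ext (R : realType) (M : manifold R) (E : bundle M) (w t : cochain E) :
  (forall x s, w x s = t x s) -> w = t.
Proof.
move=> h; apply: functional_extensionality_dep => x.
by apply/funext => s; exact: h.
Qed.

(** * Fields of forms and their evaluation on sections *)

Section Forms.
Variables (R : realType) (M : manifold R) (E : bundle M).
Implicit Types (w t : cochain E) (X Y : sec E) (Xs Ys : seq (sec E)) (f g : M -> R).

Fixpoint all_smooth Xs : Prop :=
  if Xs is X :: Xs' then smooth_sec X /\ all_smooth Xs' else True.

Lemma form_multilinear k w x : is_form k w -> multilinear (w x).
Proof. by case=> _ lin alt _; split; [exact: lin|exact: alt]. Qed.

Definition scale_form f w : cochain E := fun x s => f x * w x s.

Lemma is_form0 k : is_form k (cochain0 E).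
Proof.
split=> //; first by move=> *; rewrite /cochain0 mulr0 addr0.
by move=> *; exact: smooth_on_cst.
Qed.

Lemma is_formD k w t : is_form k w -> is_form k t -> is_form k (cochainD w t).
Proof.
move=> fw ft; have mwt x := multilinearD (form_multilinear x fw) (form_multilinear x ft).
split.
- by move=> x s sk; rewrite /cochainD (form_degree fw)// (form_degree ft)// addr0.
- by move=> x s1 s2 a u v; exact: (mwt x).1.
- by move=> x s1 s2 s3 u; exact: (mwt x).2.
- move=> e fe I; apply: smooth_onD; [exact: (b_open fe)|exact: form_smooth fw _ _ _|].
  exact: form_smooth ft _ _ _.
Qed.

Lemma is_form_scale k f w : smooth f -> is_form k w -> is_form k (scale_form f w).
Proof.
move=> sf fw; have mw x := multilinearZ (f x) (form_multilinear x fw).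
split.
- by move=> x s sk; rewrite /scale_form (form_degree fw)// mulr0.
- by move=> x s1 s2 a u v; exact: (mw x).1.
- by move=> x s1 s2 s3 u; exact: (mw x).2.
- move=> e fe I; apply: smooth_onM; [exact: (b_open fe)|exact: smooth_on_sub sf|].
  exact: form_smooth fw _ _ _.
Qed.

Lemma is_formZ k a w : is_form k w -> is_form k (cochainZ a w).
Proof. by apply: (@is_form_scale k (fun=> a)); exact: smooth_cst. Qed.

Lemma is_form_of_fun f : smooth f -> is_form 0 (of_fun E f).
Proof.
move=> sf; split.
- by move=> x [].
- by move=> x [|u s1] s2 a u' v /=; rewrite mulr0 addr0.
- by move=> x [|u s1] s2 s3 u' /=.
- move=> e fe [|i I] /=; [exact: smooth_on_sub sf|exact: smooth_on_cst].
Qed.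

Lemma is_form_fun w : is_form 0 w -> w = of_fun E (fun x => w x [::]).
Proof.
by move=> fw; apply: cochain_ext => x [|v s] //=; rewrite (form_degree fw).
Qed.

(** [form_smooth] tests frame vectors only. Sections are expanded one at a time and the resulting
    frame vectors collect in I; the tail J is there for [is_form_contract]. *)
Lemma form_smooth_mixed k w (e : frame E (rank E)) Xs (I J : seq 'I_(rank E)) :
  is_form k w -> frames e -> all_smooth Xs ->
  smooth_on (fdom e) (fun x => w x ([seq tnth (fvec e x) i | i <- I] ++
    eval_at x Xs ++ [seq tnth (fvec e x) i | i <- J])).
Proof.
move=> fw fe; elim: Xs I => [|X Xs IH] I /=.
  move=> _; have := form_smooth fw fe (I ++ J); congr smooth_on.
  by apply/funext => x; rewrite map_cat.
move=> [sX sXs].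
apply: (@smooth_on_eq _ _ _ (fun x => \sum_i coord (fvec e x) i (X x) *
  w x ([seq tnth (fvec e x) i | i <- rcons I i] ++
    eval_at x Xs ++ [seq tnth (fvec e x) i | i <- J]))).
- exact: (b_open fe).
- move=> x ex; rewrite {2}(coord_basis (b_basis fe ex) (memvf (X x))).
  rewrite form_slot_sum; last exact: form_multilinear fw.
  apply: eq_bigr => i _; rewrite form_slotZ; last exact: form_multilinear fw.
  by rewrite map_rcons -cats1 -catA /= (tnth_nth 0).
- apply: smooth_on_sum; first exact: (b_open fe).
  move=> i _; apply: smooth_onM; [exact: (b_open fe)|exact: sX|exact: IH].
Qed.

Lemma form_smooth_eval k w Xs : is_form k w -> all_smooth Xs ->
  smooth (fun x => w x (eval_at x Xs)).
Proof.
move=> fw sXs; apply: smooth_on_local => x _.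
have [e fe ex] := b_cover E x; exists (fdom e) => //.
have := form_smooth_mixed [::] [::] fw fe sXs; congr smooth_on.
by apply/funext => y; rewrite /= cats0.
Qed.

(** For k = 0 the contraction is zero, which is a form of every degree, so the truncated [k.-1] is
    harmless. *)
Lemma is_form_contract k w X : is_form k w -> smooth_sec X ->
  is_form k.-1 (contract X w).
Proof.
move=> fw sX; have mw x := multilinear_contract (X x) (form_multilinear x fw).
split.
- move=> x s sk; rewrite /contract (form_degree fw)//=.
  by case: k fw sk => [|k].
- by move=> x s1 s2 a u v; exact: (mw x).1.
- by move=> x s1 s2 s3 u; exact: (mw x).2.
- move=> e fe I.
  exact: (@form_smooth_mixed k w e [:: X] [::] I fw fe (conj sX Logic.I)).
Qed.

Lemma wedge_of_fun f w : wedge (of_fun E f) w = scale_form f w.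
Proof. by apply: cochain_ext => x s; exact: wedge_at_scalar. Qed.

Section OfSec.
Variables (A : bundle M) (p : forall x, A x -> E x -> R).
Implicit Types (Z : sec A).

Lemma wedge_of_sec Z w x (s : seq (E x)) :
  wedge (of_sec p Z) w s = wedge1 (p (Z x)) (w x) s.
Proof. exact: wedge_at_linear. Qed.

Hypothesis dp : dual_pairing p.

(** [pairing_smooth] concerns global sections, so the frame vector is cut off first and the cutoff
    divided out afterwards. *)
Lemma pairing_smooth_frame Z (e : frame E (rank E)) i : smooth_sec Z -> frames e ->
  smooth_on (fdom e) (fun x => p (Z x) (tnth (fvec e x) i)).
Proof.
move=> sZ fe; apply: smooth_on_local => x ex.
have [g [K [sg _ gx _ sE]]] := bump_frame fe ex.
exists [set y | g y != 0]; first by rewrite /= gx oner_neq0.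
apply: (@smooth_on_div _ _ g) => //; last exact: open_neq0.
have := pairing_smooth dp sZ (sE i); congr smooth_on.
by apply/funext => y; rewrite /secZ (pairingZr dp).
Qed.

Lemma is_form_of_sec Z : smooth_sec Z -> is_form 1 (of_sec p Z).
Proof.
move=> sZ; split.
- by move=> x [|v [|v' s]].
- move=> x [|u [|u' s1]] [|v' s2] a u0 v /=; rewrite ?mulr0 ?addr0//.
  exact: (pairing_linear_r dp).
- by move=> x [|u [|u' s1]] [|v' s2] s3 u0.
- move=> e fe [|i [|j I]] /=; try exact: smooth_on_cst.
  exact: pairing_smooth_frame.
Qed.

Lemma wedge1_smooth_frame (a : forall x, E x -> R) (e : frame E (rank E))
    (W : forall x, seq (E x) -> R) (I : seq 'I_(rank E)) :
  frames e ->
  (forall i, smooth_on (fdom e) (fun x => a x (tnth (fvec e x) i))) ->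
  (forall I, smooth_on (fdom e) (fun x => W x [seq tnth (fvec e x) i | i <- I])) ->
  smooth_on (fdom e)
    (fun x => wedge1 (a x) (W x) [seq tnth (fvec e x) i | i <- I]).
Proof.
move=> fe sa; elim: I W => [|i I IH] W sW /=; first exact: smooth_on_cst.
have oe : open (fdom e) := b_open fe.
apply: smooth_onD => //; first exact: smooth_onM.
apply: smooth_onN => //.
have := IH (fun x (t : seq (E x)) => W x (tnth (fvec e x) i :: t)) (fun J => sW (i :: J)).
exact.
Qed.

Lemma is_form_wedge_of_sec k Z w : smooth_sec Z -> is_form k w ->
  is_form k.+1 (wedge (of_sec p Z) w).
Proof.
move=> sZ fw.
have -> : wedge (of_sec p Z) w = fun x => wedge1 (p (Z x)) (w x).
  by apply: cochain_ext => x s; exact: wedge_of_sec.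
have mw x : multilinear (wedge1 (p (Z x)) (w x)).
  apply: wedge1_multilinear; last exact: form_multilinear fw.
  by move=> c u v; exact: (pairing_linear_r dp).
split.
- move=> x s sk; apply: (@wedge1_degree _ _ _ _ _ 0%N k) => // t tk.
  exact: form_degree fw _ _ tk.
- by move=> x s1 s2 a u v; exact: (mw x).1.
- by move=> x s1 s2 s3 u; exact: (mw x).2.
- move=> e fe I; apply: wedge1_smooth_frame => //.
    by move=> i; exact: pairing_smooth_frame.
  by move=> J; exact: form_smooth fw _ _ _.
Qed.

Lemma contract_wedge_of_sec X Z w : contract X (wedge (of_sec p Z) w) =
  cochainD (scale_form (fun x => p (Z x) (X x)) w)
    (cochainZ (-1) (wedge (of_sec p Z) (contract X w))).
Proof.
apply: cochain_ext => x s.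
rewrite /contract wedge_of_sec /= /cochainD /scale_form /cochainZ wedge_of_sec.
by rewrite mulN1r.
Qed.

End OfSec.
End Forms.

(** * Lie derivatives, differentials and Schouten brackets *)

Section LieEval.
Variables (R : realType) (M : manifold R) (E : bundle M).
Implicit Types (w : cochain E) (X Y : sec E) (Xs Ys : seq (sec E)) (f g : M -> R).

Variables (x : M) (D : (M -> R) -> R) (del : sec E -> sec E).

(* The Lie derivative of a form at x, from the derivation D on functions and the
   operator del on sections: i_X L = L i_X - i_{del X}. *)
Fixpoint lie_ev w Xs : R :=
  if Xs is X :: Xs' then
    lie_ev (contract X w) Xs' - w x (del X x :: eval_at x Xs')
  else D (fun y => w y [::]).

Hypothesis tD : is_tangent x D.

Lemma lie_evD k1 k2 w1 w2 Xs : is_form k1 w1 -> is_form k2 w2 -> all_smooth Xs ->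
  lie_ev (cochainD w1 w2) Xs = lie_ev w1 Xs + lie_ev w2 Xs.
Proof.
elim: Xs k1 k2 w1 w2 => [|X Xs IH] k1 k2 w1 w2 f1 f2 /=.
  move=> _; apply: (tangentD tD).
    exact: (@form_smooth_eval _ _ _ _ _ [::] f1 Logic.I).
  exact: (@form_smooth_eval _ _ _ _ _ [::] f2 Logic.I).
move=> [sX sXs]; have := IH _ _ _ _ (is_form_contract f1 sX) (is_form_contract f2 sX) sXs.
rewrite [contract X (cochainD _ _)](_ : _ = cochainD (contract X w1) (contract X w2))//.
by move=> ->; rewrite /cochainD; ring.
Qed.

Lemma lie_ev_scale k f w Xs : smooth f -> is_form k w -> all_smooth Xs ->
  lie_ev (scale_form f w) Xs = f x * lie_ev w Xs + D f * w x (eval_at x Xs).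
Proof.
move=> sf; elim: Xs k w => [|X Xs IH] k w fw /=.
  move=> _; rewrite (tangentM tD sf); first by rewrite [X in _ + X]mulrC.
  exact: (@form_smooth_eval _ _ _ _ _ [::] fw Logic.I).
move=> [sX sXs]; have := IH _ _ (is_form_contract fw sX) sXs.
rewrite [contract X (scale_form _ _)](_ : _ = scale_form f (contract X w))// => ->.
by rewrite /scale_form /contract; ring.
Qed.

Lemma lie_evZ k a w Xs : is_form k w -> all_smooth Xs ->
  lie_ev (cochainZ a w) Xs = a * lie_ev w Xs.
Proof.
move=> fw sXs; have := lie_ev_scale (@smooth_cst R M a) fw sXs.
by rewrite (tangent_cst tD) mul0r addr0.
Qed.

Section Wedge.
Variables (A : bundle M) (p : forall x, A x -> E x -> R) (dp : dual_pairing p).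

(** The wedges run over lists of sections, since without a Leibniz rule for [del] the value of
    [lie_ev] may depend on more than the values at x; otherwise this is L(Z /\ w) = LZ /\ w + Z /\
    Lw. *)
Lemma lie_ev_wedge (Z : sec A) k w Xs : smooth_sec Z -> is_form k w -> all_smooth Xs ->
  lie_ev (wedge (of_sec p Z) w) Xs =
    wedge1 (fun X => lie_ev (of_sec p Z) [:: X]) (fun Ys => w x (eval_at x Ys)) Xs +
    wedge1 (fun X => p (Z x) (X x)) (fun Ys => lie_ev w Ys) Xs.
Proof.
move=> sZ; elim: Xs k w => [|X Xs IH] k w fw.
  rewrite /= addr0 (_ : (fun y => _) = fun=> 0).
    by move=> _; rewrite (tangent_cst tD).
  by apply/funext => y; rewrite wedge_of_sec.
move=> [sX sXs].
rewrite [LHS]/= contract_wedge_of_sec wedge_of_sec.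
have fX := is_form_contract fw sX.
have sp := pairing_smooth dp sZ sX.
have fW := is_form_wedge_of_sec dp sZ fX.
rewrite (lie_evD (is_form_scale sp fw) (is_formZ (-1) fW))//.
rewrite (lie_ev_scale sp fw)// (lie_evZ _ fW)// (IH _ _ fX)//=.
have -> : (fun Ys => lie_ev (contract X w) Ys - w x (del X x :: eval_at x Ys)) =
  (fun Ys => lie_ev (contract X w) Ys + -1 * w x (del X x :: eval_at x Ys)).
  by apply/funext => Ys; rewrite mulN1r.
rewrite (wedge1D _ (fun Ys => lie_ev (contract X w) Ys)).
rewrite (wedge1Z _ _ (fun Ys => w x (del X x :: eval_at x Ys))).
rewrite /eval_at (wedge1_map (fun Y => Y x)) /contract /=; ring.
Qed.

End Wedge.

Lemma wedge1_eval (a : E x -> R) (W : seq (E x) -> R) Xs :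
  wedge1 a W (eval_at x Xs) =
  wedge1 (fun X => a (X x)) (fun Ys => W (eval_at x Ys)) Xs.
Proof. exact: wedge1_map. Qed.

Section Derivation.
Hypothesis delD : forall X Y, smooth_sec X -> smooth_sec Y ->
  del (secD X Y) x = del X x + del Y x.
Hypothesis delZ : forall f X, smooth f -> smooth_sec X ->
  del (secZ f X) x = f x *: del X x + D f *: X x.

Lemma contractD k X Y w : is_form k w ->
  contract (secD X Y) w = cochainD (contract X w) (contract Y w).
Proof.
move=> fw; apply: cochain_ext => y s.
exact: (form_headD (form_multilinear y fw)).
Qed.

Lemma contractZ k f X w : is_form k w ->
  contract (secZ f X) w = scale_form f (contract X w).
Proof.
move=> fw; apply: cochain_ext => y s.
exact: (form_headZ (form_multilinear y fw)).
Qed.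

Lemma lie_ev_tensorial (A : bundle M) (p : forall x, E x -> A x -> R) k w Xs Ys :
  dual_pairing p -> is_form k w -> all_smooth Xs -> all_smooth Ys ->
  eval_at x Xs = eval_at x Ys -> lie_ev w Xs = lie_ev w Ys.
Proof.
move=> dp; elim: Xs Ys k w => [|X Xs IH] [|Y Ys] //= k w fw [sX sXs] [sY sYs] [XY XYs].
(* By induction the tail is replaced first. With the tail fixed the head enters tensorially: the
   [D f] terms from [contract] and from [del] cancel. *)
rewrite (IH Ys _ (contract X w) (is_form_contract fw sX))// XYs.
have mw := form_multilinear x fw.
apply: (@tensorial_eq _ _ _ _ _ dp x
  (fun X => lie_ev (contract X w) Ys - w x (del X x :: eval_at x Ys))) => //.
- move=> X1 X2 s1 s2; rewrite (contractD _ _ fw) delD// (form_headD mw).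
  rewrite (lie_evD (is_form_contract fw s1) (is_form_contract fw s2))//; ring.
- move=> f X1 sf s1; rewrite (contractZ _ _ fw) delZ// (form_headD mw) !(form_headZ mw).
  rewrite (lie_ev_scale sf (is_form_contract fw s1))// /contract; ring.
Qed.

End Derivation.
End LieEval.

Lemma multilinear2 (R : realType) (V : lmodType R) (w : seq V -> R) :
  (forall s, size s != 2 -> w s = 0) ->
  (forall a u v b, w [:: a *: u + v; b] = a * w [:: u; b] + w [:: v; b]) ->
  (forall u v, w [:: u; v] = - w [:: v; u]) -> multilinear w.
Proof.
move=> w0 lin skew; split=> [s1 s2 a u v|s1 s2 s3 u].
  have [s12|s12] := eqVneq (size s1 + size s2)%N 1%N; last first.
    by rewrite !w0 ?size_cat /= ?addnS ?eqSS//; ring.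
  case: s1 s12 => [|b [|c s1]] //; case: s2 => [|d [|d' s2]] // _ /=; first exact: lin.
  rewrite skew lin (skew b u) (skew b v); ring.
case: s1 => [|b s1]; last by rewrite w0// !size_cat /= size_cat /= !addnS.
case: s2 => [|b s2]; last by rewrite w0//= size_cat /= !addnS.
case: s3 => [|b s3] /=; last by rewrite w0.
by have := skew u u => h; lra.
Qed.

(** Each frame vector is multiplied by a cutoff g; by multilinearity this costs a factor g ^ size I,
    which is divided out where g does not vanish. *)
Lemma is_form_of_eval (R : realType) (M : manifold R) (E : bundle M) k (w : cochain E) :
  (forall x s, size s != k -> w x s = 0) -> (forall x, multilinear (w x)) ->
  (forall Xs, all_smooth Xs -> smooth (fun x => w x (eval_at x Xs))) -> is_form k w.
Proof.
move=> w0 mw sw; split => //.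
- by move=> x; exact: (mw x).1.
- by move=> x; exact: (mw x).2.
move=> e fe I; apply: smooth_on_local => x ex.
have [g [K [sg _ gx _ sE]]] := bump_frame fe ex.
exists [set y | g y != 0]; first by rewrite /= gx oner_neq0.
pose Xs := [seq secZ g (fun y => tnth (fvec e y) i) | i <- I].
have sXs : all_smooth Xs by rewrite /Xs; elim: I {Xs} => //= i I IH; split.
have sgn n : smooth (fun y => g y ^+ n).
  elim: n => [|n IH]; first exact: smooth_cst.
  have := smoothM sg IH; congr smooth.
  by apply/funext => y; rewrite exprS.
apply: (@smooth_on_div _ _ (fun y => g y ^+ size I)) => //; last exact: open_neq0.
  have := sw Xs sXs; congr smooth; apply/funext => y.
  rewrite /Xs /eval_at -map_comp.
  elim: (I) (w y) (mw y) => [|i J IH] W mW /=; first by rewrite expr0 mul1r.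
  rewrite {1}/secZ form_headZ// (IH _ (multilinear_contract _ mW)).
  by rewrite exprS mulrA.
by move=> y gy; rewrite expf_neq0.
Qed.

Lemma size_omit (T : Type) (s : seq T) i :
  (i < size s)%N -> size (omit i s) = (size s).-1.
Proof. by rewrite /omit size_cat size_take size_drop => i_lt; rewrite i_lt; lia. Qed.

(** * Cartan calculus of a Lie algebroid *)

Section Differential.
Variables (R : realType) (M : manifold R) (E : bundle M) (L : lie_algebroid E).
Implicit Types (w : cochain E) (X Y : sec E) (Xs Ys : seq (sec E)) (f g : M -> R).

Definition lie x X w Xs : R := lie_ev x (anchor L (X x)) (bracket L X) w Xs.

Lemma lie_ev_sum x D (del : sec E -> sec E) w Xs : (forall y, multilinear (w y)) ->
  lie_ev x D del w Xs = D (fun y => w y (eval_at y Xs)) +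
    \sum_(j < size Xs) (-1) ^+ j.+1 *
      w x (del (nth (@sec0 R M E) Xs j) x :: eval_at x (omit j Xs)).
Proof.
elim: Xs w => [|X Xs IH] w mw /=; first by rewrite big_ord0 addr0.
rewrite (IH _ (fun y => multilinear_contract (X y) (mw y))).
rewrite big_ord_recl /= /omit /= drop0 expr1 -addrA; congr (_ + _).
rewrite mulN1r addrC; congr (_ + _); apply: eq_bigr => j _.
rewrite /contract (form_swap _ _ _ (mw x)) [in RHS]exprS.
by rewrite mulN1r mulrN mulNr.
Qed.

Lemma diff_sec_nil w x : diff_sec L w [::] x = 0.
Proof. by rewrite /diff_sec !big_ord0 addr0. Qed.

(** Cartan's formula i_X d = L_X - d i_X, read off the defining sums: the terms involving index 0
    make up L_X. It serves as the recursion for all later facts about d. *)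
Lemma diff_sec_cons w X Xs x : (forall y, multilinear (w y)) ->
  diff_sec L w (X :: Xs) x = lie x X w Xs - diff_sec L (contract X w) Xs x.
Proof.
move=> mw; rewrite /lie lie_ev_sum// /diff_sec /= !big_ord_recl big_ord0 /=.
rewrite expr0 mul1r add0r /omit /= drop0.
set S0 := anchor L (X x) _.
rewrite [X in S0 + X + _ = _](_ : _ = - \sum_(i < size Xs) (-1) ^+ i *
    anchor L (nth (@sec0 R M E) Xs i x)
      (fun y => contract X w (eval_at y (omit i Xs)))); last first.
  rewrite -sumrN; apply: eq_bigr => i _.
  by rewrite [_ ^+ bump 0 i]exprS mulN1r mulNr.
(* The terms with i = 0 belong to L_X. In the others both indices shift by one, so their sign is
   unchanged, and exchanging X with the bracket yields the minus. *)
rewrite [X in _ + X = _](_ : _ = \sum_(j < size Xs) ((-1) ^+ j.+1 *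
    w x (bracket L X (nth (@sec0 R M E) Xs j) x :: eval_at x (omit j Xs)) -
    \sum_(i < j) (-1) ^+ (i + j) * contract X w
      (bracket L (nth (@sec0 R M E) Xs i) (nth (@sec0 R M E) Xs j) x ::
        eval_at x (omit i (omit j Xs))))); last first.
  apply: eq_bigr => j _; rewrite [LHS]big_ord_recl /= drop0; congr (_ + _).
  rewrite -sumrN; apply: eq_bigr => i _.
  rewrite /contract (form_swap _ _ _ (mw x)).
  have -> : (-1) ^+ (bump 0 i + bump 0 j) = (-1) ^+ (i + j) :> R.
    by rewrite addnS exprS addSn exprS !mulN1r opprK.
  by rewrite mulrN.
rewrite sumrB; ring.
Qed.

Lemma diff_secD k1 k2 w1 w2 Xs x : is_form k1 w1 -> is_form k2 w2 -> all_smooth Xs ->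
  diff_sec L (cochainD w1 w2) Xs x = diff_sec L w1 Xs x + diff_sec L w2 Xs x.
Proof.
elim: Xs k1 k2 w1 w2 => [|X Xs IH] k1 k2 w1 w2 f1 f2 /=.
  by rewrite !diff_sec_nil addr0.
move=> [sX sXs]; have m1 y := form_multilinear y f1; have m2 y := form_multilinear y f2.
rewrite !diff_sec_cons//; last by move=> y; exact: (multilinearD (m1 y) (m2 y)).
rewrite /lie (lie_evD _ (anchor_tangent L (X x)) f1 f2)//.
rewrite [contract X (cochainD _ _)](_ : _ = cochainD (contract X w1) (contract X w2))//.
by rewrite (IH _ _ _ _ (is_form_contract f1 sX) (is_form_contract f2 sX))//; ring.
Qed.

Lemma diff_sec_scale k f w Xs x : smooth f -> is_form k w -> all_smooth Xs ->
  diff_sec L (scale_form f w) Xs x = f x * diff_sec L w Xs x +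
    wedge1 (fun X => anchor L (X x) f) (fun Ys => w x (eval_at x Ys)) Xs.
Proof.
move=> sf; elim: Xs k w => [|X Xs IH] k w fw /=.
  by rewrite !diff_sec_nil mulr0 addr0.
move=> [sX sXs]; have mw y := form_multilinear y fw.
rewrite !diff_sec_cons//; last by move=> y; exact: (multilinearZ _ (mw y)).
rewrite /lie (lie_ev_scale _ (anchor_tangent L (X x)) sf fw)//.
rewrite [contract X (scale_form _ _)](_ : _ = scale_form f (contract X w))//.
by rewrite (IH _ _ (is_form_contract fw sX))// /contract; ring.
Qed.

Lemma lieD k w X1 X2 Xs x : is_form k w -> smooth_sec X1 -> smooth_sec X2 ->
  all_smooth Xs -> lie x (secD X1 X2) w Xs = lie x X1 w Xs + lie x X2 w Xs.
Proof.
rewrite /lie => fw s1 s2; elim: Xs k w fw => [|Y Xs IH] k w fw /=.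
  by move=> _; rewrite anchorDl//; exact: (@form_smooth_eval _ _ _ _ _ [::] fw Logic.I).
move=> [sY sXs]; rewrite (IH _ _ (is_form_contract fw sY))// bracketDl//.
by rewrite (form_headD (form_multilinear x fw)); ring.
Qed.

(** The extra term df /\ i_X w comes from [f X, Y] = f [X, Y] - Y(f) X. *)
Lemma lieZ k f w X Xs x : is_form k w -> smooth f -> smooth_sec X -> all_smooth Xs ->
  lie x (secZ f X) w Xs = f x * lie x X w Xs +
    wedge1 (fun Y => anchor L (Y x) f) (fun Ys => w x (X x :: eval_at x Ys)) Xs.
Proof.
rewrite /lie => fw sf sX; elim: Xs k w fw => [|Y Xs IH] k w fw /=.
  move=> _; rewrite addr0 anchorZl//.
  exact: (@form_smooth_eval _ _ _ _ _ [::] fw Logic.I).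
move=> [sY sXs]; have mw := form_multilinear x fw.
rewrite (IH _ _ (is_form_contract fw sY))// bracketZl//.
rewrite (form_headD mw) (form_headN mw) !(form_headZ mw) /contract.
have -> : (fun Ys => w x [:: Y x, X x & eval_at x Ys]) =
    (fun Ys => -1 * w x [:: X x, Y x & eval_at x Ys]).
  by apply/funext => Ys; rewrite mulN1r (form_swap _ _ _ mw).
by rewrite (wedge1Z _ _ (fun Ys => w x [:: X x, Y x & eval_at x Ys])) /=; ring.
Qed.

Lemma diff_sec_degree w Xs x j k : (forall y, multilinear (w y)) ->
  (forall y t, (j + size t != k)%N -> w y t = 0) -> (j + size Xs != k.+1)%N ->
  diff_sec L w Xs x = 0.
Proof.
elim: Xs w j => [|X Xs IH] w j mw w0; first by rewrite diff_sec_nil.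
rewrite addnS eqSS => jk; rewrite diff_sec_cons//.
have j' Y y t : (j.+1 + size t != k)%N -> contract Y w (x := y) t = 0.
  by move=> jt; apply: w0; rewrite /= addnS -addSn.
rewrite (IH _ j.+1 (fun y => multilinear_contract (X y) (mw y)) (j' X))//.
rewrite subr0 /lie lie_ev_sum// (_ : (fun y => _) = fun=> 0); last first.
  by apply/funext => y; apply: w0; rewrite /eval_at size_map.
rewrite anchor_cst add0r big1// => i _; rewrite w0 ?mulr0//=.
by rewrite /eval_at size_map size_omit// prednK//; case: (size Xs) i => [|n] [].
Qed.

Section Pairing.
Variables (B : bundle M) (p : forall x, E x -> B x -> R) (dp : dual_pairing p).

(** The tail is replaced by induction. For the head, dw(f X, ...) is L_(f X) w - d(f i_X w), in
    which the two terms df /\ i_X w cancel. *)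
Lemma diff_sec_eval k w Xs Ys x : is_form k w -> all_smooth Xs -> all_smooth Ys ->
  eval_at x Xs = eval_at x Ys -> diff_sec L w Xs x = diff_sec L w Ys x.
Proof.
elim: Xs Ys k w => [|X Xs IH] [|Y Ys] //= k w fw [sX sXs] [sY sYs] [XY XYs].
have mw y := form_multilinear y fw.
rewrite diff_sec_cons// (IH Ys _ (contract X w) (is_form_contract fw sX))//.
have -> : lie x X w Xs = lie x X w Ys.
  apply: (lie_ev_tensorial (anchor_tangent L (X x)) _ _ dp fw) => //.
    by move=> *; exact: bracketDr.
  by move=> *; exact: bracketZr.
rewrite -diff_sec_cons//.
apply: (@tensorial_eq _ _ _ _ _ dp x (fun X => diff_sec L w (X :: Ys) x)) => //.
- move=> X1 X2 s1 s2; rewrite !diff_sec_cons// (lieD _ fw)// (contractD _ _ fw).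
  by rewrite (diff_secD _ (is_form_contract fw s1) (is_form_contract fw s2))//; ring.
- move=> f X1 sf s1; rewrite !diff_sec_cons// (lieZ _ fw)// (contractZ _ _ fw).
  by rewrite (diff_sec_scale _ sf (is_form_contract fw s1))// /contract; ring.
Qed.

Lemma eval_sec_through x (s : seq (E x)) :
  all_smooth [seq sec_through v | v <- s] /\
  eval_at x [seq sec_through v | v <- s] = s.
Proof.
elim: s => [|v s [IH1 IH2]] //=; have [sv vv] := sec_throughP dp v.
by rewrite /eval_at /= vv; split=> //; congr cons.
Qed.

Lemma diff_eval k w Xs x : is_form k w -> all_smooth Xs ->
  diff L w (eval_at x Xs) = diff_sec L w Xs x.
Proof.
move=> fw sXs; have [s1 s2] := eval_sec_through (eval_at x Xs).
exact: (diff_sec_eval fw).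
Qed.

Lemma diff_degree k w x (s : seq (E x)) : is_form k w -> size s != k.+1 -> diff L w s = 0.
Proof.
move=> fw sk; apply: (@diff_sec_degree _ _ _ 0%N k).
- by move=> y; exact: form_multilinear fw.
- by move=> y t tk; exact: form_degree fw _ _ tk.
- by rewrite add0n size_map.
Qed.

Lemma cartan k w X Xs x : is_form k w -> smooth_sec X -> all_smooth Xs ->
  diff L (contract X w) (eval_at x Xs) + contract X (diff L w) (eval_at x Xs) =
  lie x X w Xs.
Proof.
move=> fw sX sXs; rewrite (diff_eval _ (is_form_contract fw sX))//.
rewrite [contract X _ _](_ : _ = diff L w (eval_at x (X :: Xs)))//.
rewrite (diff_eval _ fw)//= diff_sec_cons; last by move=> y; exact: form_multilinear fw.
by rewrite addrC subrK.
Qed.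

Lemma diff_form1 w X Y x : is_form 1 w -> smooth_sec X -> smooth_sec Y ->
  diff L w [:: X x; Y x] = anchor L (X x) (fun y => w y [:: Y y]) -
    anchor L (Y x) (fun y => w y [:: X y]) - w x [:: bracket L X Y x].
Proof.
move=> fw sX sY; have mw y := form_multilinear y fw.
rewrite [LHS](@diff_eval _ _ [:: X; Y] x fw)// diff_sec_cons// diff_sec_cons; last first.
  by move=> y; exact: (multilinear_contract (X y) (mw y)).
by rewrite diff_sec_nil /lie /= /contract; ring.
Qed.

(** Needed because d_* Y is itself an argument of the Schouten bracket in the first axiom. *)
Lemma is_form_diff1 w : is_form 1 w -> is_form 2 (diff L w).
Proof.
move=> fw; have mw y := form_multilinear y fw.
have sw X : smooth_sec X -> smooth (fun y => w y [:: X y]).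
  by move=> sX; exact: (@form_smooth_eval _ _ _ _ _ [:: X] fw (conj sX Logic.I)).
apply: is_form_of_eval.
- by move=> x s; exact: diff_degree.
- move=> x; apply: multilinear2.
  + by move=> s; exact: diff_degree.
  + move=> a u v b.
    have [sU <-] := sec_throughP dp u; have [sV <-] := sec_throughP dp v.
    have [sB <-] := sec_throughP dp b.
    set U := sec_through u; set V := sec_through v; set B' := sec_through b.
    have sa : smooth_sec (secZ (fun=> a) U).
      by apply: smooth_secZ => //; exact: smooth_cst.
    rewrite (_ : a *: U x + V x = secD (secZ (fun=> a) U) V x)//.
    rewrite !diff_form1//; last exact: smooth_secD.
    rewrite bracketDl// bracketZl//; last exact: smooth_cst.
    rewrite anchor_cst scale0r subr0 (form_headD (mw x)) (form_headZ (mw x)).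
    rewrite anchorDl; last exact: sw.
    rewrite /secZ anchorZl; last exact: sw.
    rewrite (_ : (fun y => w y [:: secD _ _ y]) =
      fun y => a * w y [:: U y] + w y [:: V y]); last first.
      by apply/funext => y; rewrite (form_headD (mw y)) (form_headZ (mw y)).
    rewrite anchorD; [|apply: smoothM; [exact: smooth_cst|exact: sw]|exact: sw].
    rewrite anchorM; [|exact: smooth_cst|exact: sw].
    rewrite anchor_cst; ring.
  + move=> u v.
    have [sU <-] := sec_throughP dp u; have [sV <-] := sec_throughP dp v.
    by rewrite !diff_form1// bracketC// (form_headN (mw x)); ring.
- move=> Xs; have [s2|s2] := eqVneq (size Xs) 2; last first.
    move=> _; rewrite (_ : (fun x => _) = fun=> 0); first exact: smooth_cst.
    by apply/funext => x; rewrite (diff_degree fw)// /eval_at size_map.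
  case: Xs s2 => [|X [|Y [|Z Xs]]]//= _ [sX [sY _]].
  rewrite (_ : (fun x => _) = fun x => anchor L (X x) (fun y => w y [:: Y y]) -
    anchor L (Y x) (fun y => w y [:: X y]) - w x [:: bracket L X Y x]).
    apply: smoothB; last by apply: sw; exact: bracket_smooth.
    by apply: smoothB; apply: anchor_smooth => //; exact: sw.
  by apply/funext => x; rewrite diff_form1.
Qed.

End Pairing.
End Differential.

Section CochainSum.
Variables (R : realType) (M : manifold R) (E : bundle M) (I : Type).

Definition cochain_sum (r : seq I) (w : I -> cochain E) : cochain E :=
  fun x s => \sum_(i <- r) w i x s.

Lemma cochain_sum_nil w : cochain_sum [::] w = cochain0 E.
Proof. by apply: cochain_ext => x s; rewrite /cochain_sum big_nil. Qed.

(** The factor 1 matches the shape of [sch_linear_r]. *)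
Lemma cochain_sum_cons i r w :
  cochain_sum (i :: r) w = cochainD (cochainZ 1 (w i)) (cochain_sum r w).
Proof.
by apply: cochain_ext => x s; rewrite /cochain_sum big_cons /cochainD /cochainZ mul1r.
Qed.

Lemma is_form_sum k r w : (forall i, is_form k (w i)) -> is_form k (cochain_sum r w).
Proof.
move=> fw; elim: r => [|i r IH]; first by rewrite cochain_sum_nil; exact: is_form0.
by rewrite cochain_sum_cons; apply: is_formD => //; exact: is_formZ.
Qed.

Lemma lie_ev_csum x D del k r w Xs : is_tangent x D -> (forall i, is_form k (w i)) ->
  all_smooth Xs ->
  lie_ev x D del (cochain_sum r w) Xs = \sum_(i <- r) lie_ev x D del (w i) Xs.
Proof.
move=> tD fw sXs; elim: r => [|i r IH].
  rewrite cochain_sum_nil big_nil -(mul0r (lie_ev x D del (cochain0 E) Xs)).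
  rewrite -(lie_evZ _ tD 0 (is_form0 E k))//; congr lie_ev.
  by apply: cochain_ext => y s; rewrite /cochainZ mul0r.
rewrite cochain_sum_cons (lie_evD _ tD (is_formZ 1 (fw i)) (is_form_sum r fw))//.
by rewrite (lie_evZ _ tD 1 (fw i))// mul1r IH big_cons.
Qed.

End CochainSum.

Lemma wedge1_ext_smooth (R : realType) (M : manifold R) (E : bundle M)
    (a b : sec E -> R) (W W' : seq (sec E) -> R) (Xs : seq (sec E)) :
  (forall X, smooth_sec X -> a X = b X) ->
  (forall Ys, all_smooth Ys -> (size Ys).+1 = size Xs -> W Ys = W' Ys) ->
  all_smooth Xs -> wedge1 a W Xs = wedge1 b W' Xs.
Proof.
move=> ab; elim: Xs W W' => [|X Xs IH] W W' WW' //= [sX sXs].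
rewrite ab// WW'//; congr (_ - _); apply: IH => // Ys sYs YX.
by apply: WW' => //=; rewrite YX.
Qed.

(** * Brackets with a section as Lie derivatives *)

Section SchoutenEval.
Variables (R : realType) (M : manifold R) (A B : bundle M).
Variables (p : forall x, A x -> B x -> R) (dp : dual_pairing p).
Variables (L : lie_algebroid A) (S : schouten p L).
Implicit Types (X Y : sec A) (al be : sec B) (P : cochain B) (als : seq (sec B)).

Lemma sch0 k P : is_form k P -> sch S P (cochain0 B) = cochain0 B.
Proof.
move=> fP; have := sch_linear_r S 1 fP (is_form0 B 0) (is_form0 B 0).
have -> : cochainD (cochainZ 1 (cochain0 B)) (cochain0 B) = cochain0 B.
  by apply: cochain_ext => x s; rewrite /cochainD /cochainZ /cochain0 mulr0 addr0.
move=> h; apply: cochain_ext => x s; have := congr1 (fun w : cochain B => w x s) h.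
rewrite /cochainD /cochainZ /cochain0 mul1r => e; lra.
Qed.

Lemma sch_sum k k' P (I : Type) (r : seq I) (w : I -> cochain B) :
  is_form k P -> (forall i, is_form k' (w i)) ->
  sch S P (cochain_sum r w) = cochain_sum r (fun i => sch S P (w i)).
Proof.
move=> fP fw; elim: r => [|i r IH]; first by rewrite !cochain_sum_nil (sch0 fP).
rewrite !cochain_sum_cons (sch_linear_r S 1 fP (fw i) (is_form_sum r fw)).
by rewrite IH.
Qed.

Lemma schZ k k' P c w : is_form k P -> is_form k' w ->
  sch S P (cochainZ c w) = cochainZ c (sch S P w).
Proof.
move=> fP fw; have := sch_linear_r S c fP fw (is_form0 B k'); rewrite (sch0 fP).
have e w' : cochainD w' (cochain0 B) = w'.
  by apply: cochain_ext => x s; rewrite /cochainD /cochain0 addr0.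
by rewrite !e.
Qed.

Local Notation lieP X P als x :=
  (lie_ev x (anchor L (X x)) (lie_derivative p L X) P als).

Lemma lie_ev_of_sec X Y al x : smooth_sec X -> smooth_sec Y -> smooth_sec al ->
  lieP X (of_sec p Y) [:: al] x = p (bracket L X Y x) (al x).
Proof.
move=> sX sY sal; have [_ h] := lie_derivativeP dp L sX sal.
by rewrite /= /contract /= h//; ring.
Qed.

Lemma sch_eval k X P als x : smooth_sec X -> is_form k P -> all_smooth als ->
  size als = k -> sch S (of_sec p X) P (eval_at x als) = lieP X P als x.
Proof.
move=> sX; have fX := is_form_of_sec dp sX.
have tX := anchor_tangent L (X x).
elim: k P als => [|k IH] P als fP sals szals.
  case: als sals szals => // _ _; rewrite (is_form_fun fP) sch_sec_fun//.
  exact: (@form_smooth_eval _ _ _ _ _ [::] fP Logic.I).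
have [n [E [F [f [[sf fx] sE sF _ exF]]]]] := pairing_frames dp x.
have fPi i : is_form k (contract (F i) P) := is_form_contract fP (sF i).
have fW i := is_form_wedge_of_sec dp (sE i) (fPi i).
(* By Euler's identity Q is (k + 1) f P. Bracket and Lie derivative of f P produce the same extra
   term X(f) P, and f x = 1, so agreement on Q gives agreement on P after division by k + 1. *)
pose Q := cochain_sum (index_enum 'I_n)
  (fun i => wedge (of_sec p (E i)) (contract (F i) P)).
have QE : Q = cochainZ k.+1%:R (scale_form f P).
  apply: cochain_ext => y s; rewrite /Q /cochain_sum /cochainZ /scale_form.
  under eq_bigr do rewrite wedge_of_sec.
  rewrite (wedge1_euler (h := f y) _ _ (form_multilinear y fP)); last first.
    by move=> u; exact: exF.
  have [->|sk] := eqVneq (size s) k.+1; first by rewrite mulrA.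
  by rewrite (form_degree fP)// !mulr0.
have ffP := is_form_scale sf fP.
have e1 : lieP X Q als x = k.+1%:R * (lieP X P als x +
    anchor L (X x) f * P x (eval_at x als)).
  by rewrite QE (lie_evZ _ tX _ ffP)// (lie_ev_scale _ tX sf fP)// fx mul1r.
have e2 : sch S (of_sec p X) Q (eval_at x als) =
    k.+1%:R * (sch S (of_sec p X) P (eval_at x als) +
    anchor L (X x) f * P x (eval_at x als)).
  rewrite QE (schZ _ fX ffP) -wedge_of_fun (sch_leibniz S fX (is_form_of_fun B sf) fP).
  rewrite sch_sec_fun// !wedge_of_fun /cochainZ /cochainD /scale_form fx mul0n expr0.
  by ring.
suff e3 : sch S (of_sec p X) Q (eval_at x als) = lieP X Q als x.
  have := e3; rewrite e1 e2 => /mulfI; rewrite pnatr_eq0 => /(_ isT).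
  by move/addIr.
rewrite /Q (sch_sum _ fX fW) (lie_ev_csum _ _ tX fW)// /cochain_sum.
(* On E_i /\ i_(F_i) P both sides obey the same Leibniz rule, and the induction hypothesis applies
   to the contraction. *)
apply: eq_bigr => i _; rewrite (lie_ev_wedge _ tX dp (sE i) (fPi i))//.
rewrite (sch_leibniz S fX (is_form_of_sec dp (sE i)) (fPi i)) sch_sec_sec//.
rewrite /cochainD /cochainZ mul1n sqrrN expr1n mul1r.
rewrite !wedge_of_sec !wedge1_eval; congr (_ + _).
  apply: wedge1_ext_smooth => // al sal.
  by rewrite lie_ev_of_sec.
apply: wedge1_ext_smooth => // bes sbes szb; apply: IH => //.
by apply: succn_inj; rewrite szb.
Qed.

End SchoutenEval.

Ltac smooth_tac := repeat first
  [ assumption | exact: smooth_cst | apply: smoothB | apply: smoothD | apply: smoothM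
  | apply: smoothN | apply: anchor_smooth | apply: bracket_smooth
  | apply: smooth_secD | apply: smooth_secZ
  | match goal with
    | dp : dual_pairing _ |- _ =>
      first [ apply: (pairing_smooth dp) | apply: (lie_derivativeP dp _ _ _).1
            | apply: (gradientP dp _ _).1 ]
    end ].

(** * Duality *)

Section LieDerivativeScale.
Variables (R : realType) (M : manifold R) (A B : bundle M).
Variables (p : forall x, A x -> B x -> R) (q : forall x, B x -> A x -> R).
Hypotheses (dp : dual_pairing p) (dq : dual_pairing q).
Hypothesis pq : forall x u l, q (x := x) l u = p u l.
Variable L : lie_algebroid A.

Lemma lie_derivativeE X al Y x : smooth_sec X -> smooth_sec al -> smooth_sec Y ->
  p (Y x) (lie_derivative p L X al x) =
  anchor L (X x) (fun y => p (Y y) (al y)) - p (bracket L X Y x) (al x).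
Proof. by move=> sX sal sY; exact: (lie_derivativeP dp L sX sal).2. Qed.

Lemma gradientE f Y x : smooth f -> smooth_sec Y ->
  p (Y x) (gradient p L f x) = anchor L (Y x) f.
Proof. by move=> sf sY; exact: (gradientP dp L sf).2. Qed.

Lemma sec_separate x (l m : B x) :
  (forall Y : sec A, smooth_sec Y -> p (Y x) l = p (Y x) m) -> l = m.
Proof.
move=> h; apply: (pairing_nondegenerate dq) => u; rewrite !pq.
by have [sY <-] := sec_throughP dp u; exact: h.
Qed.

Lemma lie_derivativeZ f X al x : smooth f -> smooth_sec X -> smooth_sec al ->
  lie_derivative p L (secZ f X) al x =
  f x *: lie_derivative p L X al x + p (X x) (al x) *: gradient p L f x.
Proof.
move=> sf sX sal; apply: sec_separate => Y sY.
rewrite lie_derivativeE//; last exact: smooth_secZ.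
rewrite (pairingDr dp) !(pairingZr dp) lie_derivativeE// gradientE//.
rewrite bracketZl// (pairingDl dp) (pairingNl dp) !(pairingZl dp) anchorZl; first ring.
by smooth_tac.
Qed.

End LieDerivativeScale.

(** * The defect of the bracket axiom and its behaviour under scaling *)

Section Defect.
Variables (R : realType) (M : manifold R) (A B : bundle M).
Variables (p : forall x, A x -> B x -> R) (q : forall x, B x -> A x -> R).
Hypotheses (dp : dual_pairing p) (dq : dual_pairing q).
Hypothesis pq : forall x u l, q (x := x) l u = p u l.
Variables (LA : lie_algebroid A) (LB : lie_algebroid B) (S : schouten p LA).
Variables (phi0 : sec B) (X0 : sec A).
Hypotheses (sphi : smooth_sec phi0) (sX0 : smooth_sec X0).
Implicit Types (X Y Z : sec A) (al be : sec B) (f g : M -> R).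

Local Notation lieA := (lie_derivative p LA).
Local Notation lieB := (lie_derivative q LB).
Local Notation grad := (gradient p LA).

Definition dX0 Y : cochain B := tdiff LB (of_sec p X0) (of_sec p Y).

Lemma is_form_dX0 Y : smooth_sec Y -> is_form 2 (dX0 Y).
Proof.
move=> sY; apply: is_formD.
  exact: (is_form_diff1 _ dq (is_form_of_sec dp sY)).
exact: (is_form_wedge_of_sec dp sX0 (is_form_of_sec dp sY)).
Qed.

Lemma dX0E Y al be x : smooth_sec Y -> smooth_sec al -> smooth_sec be ->
  dX0 Y [:: al x; be x] = anchor LB (al x) (fun y => p (Y y) (be y)) -
    anchor LB (be x) (fun y => p (Y y) (al y)) - p (Y x) (bracket LB al be x) +
    p (X0 x) (al x) * p (Y x) (be x) - p (X0 x) (be x) * p (Y x) (al x).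
Proof.
move=> sY sal sbe.
rewrite /dX0 /tdiff /cochainD (diff_form1 LB dq x (is_form_of_sec dp sY))//.
rewrite wedge_of_sec /=.
by ring.
Qed.

(** Trading [al, be]_* for the Lie derivative of Y keeps brackets such as [al, L_X be]_* out of the
    expansions when be is itself a Lie derivative or a gradient. *)
Lemma dX0_lie Y al be x : smooth_sec Y -> smooth_sec al -> smooth_sec be ->
  dX0 Y [:: al x; be x] = p (lieB al Y x) (be x) -
    anchor LB (be x) (fun y => p (Y y) (al y)) +
    p (X0 x) (al x) * p (Y x) (be x) - p (X0 x) (be x) * p (Y x) (al x).
Proof.
move=> sY sal sbe; rewrite dX0E//.
have := lie_derivativeE dq LB x sal sY sbe; rewrite !pq => ->.
rewrite (_ : (fun y => q (be y) (Y y)) = fun y => p (Y y) (be y)); first ring.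
by apply/funext => y; rewrite pq.
Qed.

Lemma dX0Z f Y al be x : smooth f -> smooth_sec Y -> smooth_sec al -> smooth_sec be ->
  dX0 (secZ f Y) [:: al x; be x] = f x * dX0 Y [:: al x; be x] +
    anchor LB (al x) f * p (Y x) (be x) - anchor LB (be x) f * p (Y x) (al x).
Proof.
move=> sf sY sal sbe; have sfY := smooth_secZ sf sY; rewrite !dX0E//.
have fY ga : (fun y => p (secZ f Y y) (ga y)) = fun y => f y * p (Y y) (ga y).
  by apply/funext => y; rewrite (pairingZl dp).
rewrite !fY !anchorM; [|smooth_tac..].
by rewrite !(pairingZl dp); ring.
Qed.

Lemma dX0D Y Z al be x : smooth_sec Y -> smooth_sec Z -> smooth_sec al ->
  smooth_sec be -> dX0 (secD Y Z) [:: al x; be x] =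
  dX0 Y [:: al x; be x] + dX0 Z [:: al x; be x].
Proof.
move=> sY sZ sal sbe; have sYZ := smooth_secD sY sZ; rewrite !dX0E//.
have YZ ga : (fun y => p (secD Y Z y) (ga y)) = fun y => p (Y y) (ga y) + p (Z y) (ga y).
  by apply/funext => y; rewrite (pairingDl dp).
rewrite !YZ !anchorD; [|smooth_tac..].
by rewrite !(pairingDl dp); ring.
Qed.

(** In degree 1 the factor k - 1 of the first correction vanishes, and the contraction of X with
    phi0 is a function. *)
Lemma tschE X k P : tsch S phi0 1 k (of_sec p X) P =
  cochainD (sch S (of_sec p X) P)
    (cochainZ (- (k%:R - 1)) (scale_form (fun y => p (X y) (phi0 y)) P)).
Proof.
rewrite /tsch (_ : contract phi0 (of_sec p X) = of_fun B (fun y => p (X y) (phi0 y))).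
  rewrite wedge_of_fun; apply: cochain_ext => y s.
  by rewrite /cochainD /cochainZ; ring.
by apply: cochain_ext => y [].
Qed.

Lemma is_form_tsch X k P : smooth_sec X -> is_form k P ->
  is_form k (tsch S phi0 1 k (of_sec p X) P).
Proof.
move=> sX fP; rewrite tschE; apply: is_formD.
  exact: (sch_degree S (is_form_of_sec dp sX) fP).
apply: is_formZ; apply: is_form_scale => //; exact: (pairing_smooth dp).
Qed.

Lemma tsch_eval X k P als x : smooth_sec X -> is_form k P -> all_smooth als ->
  size als = k -> tsch S phi0 1 k (of_sec p X) P (eval_at x als) =
  lie_ev x (anchor LA (X x)) (lieA X) P als -
  (k%:R - 1) * p (X x) (phi0 x) * P x (eval_at x als).
Proof.
move=> sX fP sals sz; rewrite tschE /cochainD /cochainZ (sch_eval dp S _ sX fP)//.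
by rewrite /scale_form; ring.
Qed.

Definition defect X Y : cochain B :=
  cochainD (dX0 (bracket LA X Y)) (cochainZ (-1)
    (cochainD (tsch S phi0 1 2 (of_sec p X) (dX0 Y))
      (cochainZ (-1) (tsch S phi0 1 2 (of_sec p Y) (dX0 X))))).

Definition lie_half X Y al be x : R :=
  anchor LA (X x) (fun y => dX0 Y [:: al y; be y]) -
  dX0 Y [:: al x; lieA X be x] - dX0 Y [:: lieA X al x; be x] -
  p (X x) (phi0 x) * dX0 Y [:: al x; be x].

Lemma is_form_defect X Y : smooth_sec X -> smooth_sec Y -> is_form 2 (defect X Y).
Proof.
move=> sX sY; apply: is_formD; first by apply: is_form_dX0; exact: bracket_smooth.
apply/is_formZ/is_formD; last apply: is_formZ; apply: is_form_tsch => //;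
  exact: is_form_dX0.
Qed.

Lemma defectE X Y al be x :
  smooth_sec X -> smooth_sec Y -> smooth_sec al -> smooth_sec be ->
  defect X Y [:: al x; be x] = dX0 (bracket LA X Y) [:: al x; be x] -
    lie_half X Y al be x + lie_half Y X al be x.
Proof.
move=> sX sY sal sbe; have sals : all_smooth [:: al; be] by [].
have h Z W : smooth_sec Z -> smooth_sec W ->
    tsch S phi0 1 2 (of_sec p Z) (dX0 W) [:: al x; be x] = lie_half Z W al be x.
  move=> sZ sW.
  rewrite [LHS](@tsch_eval Z 2 (dX0 W) [:: al; be] x sZ (is_form_dX0 sW))//=.
  rewrite /lie_half /contract; ring.
by rewrite /defect /cochainD /cochainZ !h//; ring.
Qed.

Definition obstruction X f al x : R :=
  anchor LB (al x) (fun y => anchor LA (X y) f) -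
  anchor LA (X x) (fun y => anchor LB (al y) f) +
  anchor LB (lieA X al x) f + p (X x) (phi0 x) * anchor LB (al x) f +
  dX0 X [:: grad f x; al x].

Lemma smooth_dX0 Y al be : smooth_sec Y -> smooth_sec al -> smooth_sec be ->
  smooth (fun y => dX0 Y [:: al y; be y]).
Proof.
move=> sY sal sbe.
exact: (@form_smooth_eval _ _ _ _ _ [:: al; be] (is_form_dX0 sY)
  (conj sal (conj sbe Logic.I))).
Qed.

Lemma lie_half_scale_r f X Y al be x : smooth f ->
  smooth_sec X -> smooth_sec Y -> smooth_sec al -> smooth_sec be ->
  lie_half X (secZ f Y) al be x = f x * lie_half X Y al be x +
    anchor LA (X x) f * dX0 Y [:: al x; be x] +
    anchor LB (al x) f * p (bracket LA X Y x) (be x) -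
    anchor LB (be x) f * p (bracket LA X Y x) (al x) +
    (anchor LA (X x) (fun y => anchor LB (al y) f) - anchor LB (lieA X al x) f -
     p (X x) (phi0 x) * anchor LB (al x) f) * p (Y x) (be x) -
    (anchor LA (X x) (fun y => anchor LB (be y) f) - anchor LB (lieA X be x) f -
     p (X x) (phi0 x) * anchor LB (be x) f) * p (Y x) (al x).
Proof.
move=> sf sX sY sal sbe; rewrite /lie_half.
have -> : (fun y => dX0 (secZ f Y) [:: al y; be y]) =
    fun y => (f y * dX0 Y [:: al y; be y] + anchor LB (al y) f * p (Y y) (be y)) -
      anchor LB (be y) f * p (Y y) (al y).
  by apply/funext => y; rewrite dX0Z.
have sQ := smooth_dX0 sY sal sbe.
rewrite anchorB; [|smooth_tac..]; rewrite anchorD; [|smooth_tac..].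
rewrite !anchorM; [|smooth_tac..].
rewrite !dX0Z; [|smooth_tac..].
by rewrite !(lie_derivativeE dp LA)//; ring.
Qed.

Lemma lie_half_scale_l f X Y al be x : smooth f ->
  smooth_sec X -> smooth_sec Y -> smooth_sec al -> smooth_sec be ->
  lie_half (secZ f X) Y al be x = f x * lie_half X Y al be x +
    p (X x) (be x) * dX0 Y [:: grad f x; al x] -
    p (X x) (al x) * dX0 Y [:: grad f x; be x].
Proof.
move=> sf sX sY sal sbe; rewrite /lie_half.
have mQ := form_multilinear x (is_form_dX0 sY).
have sQ := smooth_dX0 sY sal sbe.
rewrite /secZ anchorZl// !(lie_derivativeZ dp dq pq)// (pairingZl dp).
rewrite (form_headD mQ) !(form_headZ mQ).
have mQ' := multilinear_contract (al x) mQ.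
rewrite (form_headD mQ') !(form_headZ mQ').
by rewrite (form_swap (al x) (grad f x) _ mQ); ring.
Qed.

Lemma defect_scale f X Y al be x : smooth f ->
  smooth_sec X -> smooth_sec Y -> smooth_sec al -> smooth_sec be ->
  defect X (secZ f Y) [:: al x; be x] = f x * defect X Y [:: al x; be x] +
    obstruction X f al x * p (Y x) (be x) - obstruction X f be x * p (Y x) (al x).
Proof.
move=> sf sX sY sal sbe; rewrite !defectE//; last exact: smooth_secZ.
rewrite lie_half_scale_r// lie_half_scale_l// bracket_leibniz//.
rewrite dX0D; [|smooth_tac..].
rewrite !dX0Z; [|smooth_tac..].
by rewrite /obstruction; ring.
Qed.

(** The two bracket terms have different origins: {f, g} comes from d_*(g X) evaluated on df, and
    {g, f} from L_(g X) al = g L_X al + <X, al> dg. *)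
Lemma obstruction_scale f g X al x : smooth f -> smooth g -> smooth_sec X ->
  smooth_sec al -> obstruction (secZ g X) f al x = g x * obstruction X f al x +
    (anchor LB (grad f x) g + anchor LB (grad g x) f) * p (X x) (al x).
Proof.
move=> sf sg sX sal; rewrite /obstruction.
have -> : (fun y => anchor LA (secZ g X y) f) = fun y => g y * anchor LA (X y) f.
  by apply/funext => y; rewrite anchorZl.
rewrite anchorM; [|smooth_tac..].
rewrite dX0Z; [|smooth_tac..].
rewrite (lie_derivativeZ dp dq pq)// anchorDl// !anchorZl; [|smooth_tac..].
by rewrite (pairingZl dp) (gradientE dp)//; ring.
Qed.

Lemma obstructionE f X al x : smooth f -> smooth_sec X -> smooth_sec al ->
  obstruction X f al x =
    anchor LB (al x) (fun y => anchor LA (X y) f) -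
    anchor LA (X x) (fun y => anchor LB (al y) f) +
    anchor LB (lieA X al x) f - anchor LA (lieB al X x) f +
    p (X x) (phi0 x) * anchor LB (al x) f - p (X0 x) (al x) * anchor LA (X x) f +
    anchor LB (grad f x) (fun y => p (X y) (al y)) +
    anchor LA (X0 x) f * p (X x) (al x).
Proof.
move=> sf sX sal; rewrite /obstruction.
have mQ := form_multilinear x (is_form_dX0 sX).
rewrite (form_swap _ _ _ mQ) dX0_lie; [|smooth_tac..].
have slB : smooth_sec (lieB al X) by smooth_tac.
by rewrite !(gradientE dp)//; ring.
Qed.

Lemma lie_half_expand X Y al be x :
  smooth_sec X -> smooth_sec Y -> smooth_sec al -> smooth_sec be ->
  lie_half X Y al be x =
    anchor LA (X x) (fun y => anchor LB (al y) (fun z => p (Y z) (be z))) -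
    anchor LA (X x) (fun y => anchor LB (be y) (fun z => p (Y z) (al z))) -
    anchor LA (X x) (fun y => p (Y y) (bracket LB al be y)) -
    p (lieB al Y x) (lieA X be x) + p (lieB be Y x) (lieA X al x) +
    anchor LB (lieA X be x) (fun y => p (Y y) (al y)) -
    anchor LB (lieA X al x) (fun y => p (Y y) (be y)) +
    p (X0 x) (al x) * p (bracket LA X Y x) (be x) -
    p (X0 x) (be x) * p (bracket LA X Y x) (al x) +
    p (bracket LA X X0 x) (al x) * p (Y x) (be x) -
    p (bracket LA X X0 x) (be x) * p (Y x) (al x) -
    p (X x) (phi0 x) * (anchor LB (al x) (fun y => p (Y y) (be y)) -
      anchor LB (be x) (fun y => p (Y y) (al y)) - p (Y x) (bracket LB al be x) +
      p (X0 x) (al x) * p (Y x) (be x) - p (X0 x) (be x) * p (Y x) (al x)).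
Proof.
move=> sX sY sal sbe; rewrite /lie_half.
have -> : (fun y => dX0 Y [:: al y; be y]) = fun y =>
    anchor LB (al y) (fun z => p (Y z) (be z)) -
    anchor LB (be y) (fun z => p (Y z) (al z)) - p (Y y) (bracket LB al be y) +
    p (X0 y) (al y) * p (Y y) (be y) - p (X0 y) (be y) * p (Y y) (al y).
  by apply/funext => y; rewrite dX0E.
rewrite anchorB; [|smooth_tac..]; rewrite anchorD; [|smooth_tac..].
rewrite anchorB; [|smooth_tac..]; rewrite anchorB; [|smooth_tac..].
rewrite !anchorM; [|smooth_tac..].
have mQ := form_multilinear x (is_form_dX0 sY).
rewrite (form_swap (lieA X al x) _ _ mQ).
have sLal : smooth_sec (lieA X al) by smooth_tac.
have sLbe : smooth_sec (lieA X be) by smooth_tac.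
rewrite (dX0_lie _ sY sal sLbe) (dX0_lie _ sY sbe sLal) (dX0E _ sY sal sbe).
rewrite (lie_derivativeE dp LA x sX sal sY) (lie_derivativeE dp LA x sX sbe sY).
rewrite (lie_derivativeE dp LA x sX sal sX0) (lie_derivativeE dp LA x sX sbe sX0).
ring.
Qed.

End Defect.

Section Duality.
Variables (R : realType) (M : manifold R) (A B : bundle M).
Variables (p : forall x, A x -> B x -> R) (q : forall x, B x -> A x -> R).
Hypotheses (dp : dual_pairing p) (dq : dual_pairing q).
Hypothesis qp : forall x u l, q (x := x) l u = p u l.
Variables (LA : lie_algebroid A) (LB : lie_algebroid B).
Variables (SA : schouten p LA) (SB : schouten q LB).
Variables (phi0 : sec B) (X0 : sec A).
Hypotheses (sphi : smooth_sec phi0) (sX0 : smooth_sec X0).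
Implicit Types (X Y Z : sec A) (al be : sec B) (f g : M -> R).

Lemma pq x (l : B x) (u : A x) : p u l = q l u. Proof. by rewrite qp. Qed.

(** E(X, al) of the overview: the corrected commutator of the two anchors plus a multiplication
    operator. It changes sign when the two algebroids are exchanged, as the difference of the
    defects does. *)
Definition mixed X al f x : R :=
  anchor LB (al x) (fun y => anchor LA (X y) f) -
  anchor LA (X x) (fun y => anchor LB (al y) f) +
  anchor LB (lie_derivative p LA X al x) f -
  anchor LA (lie_derivative q LB al X x) f +
  p (X x) (phi0 x) * anchor LB (al x) f - p (X0 x) (al x) * anchor LA (X x) f +
  (p (X x) (bracket LB al phi0 x) - p (bracket LA X X0 x) (al x)) * f x.

(* Up to terms in which the two algebroids play symmetric parts, the defects of
   the two bialgebroid axioms agree. *)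
Lemma defect_duality X Y al be x :
  smooth_sec X -> smooth_sec Y -> smooth_sec al -> smooth_sec be ->
  defect LB SA phi0 X0 X Y [:: al x; be x] -
    defect LA SB X0 phi0 al be [:: X x; Y x] =
  mixed X al (fun y => p (Y y) (be y)) x - mixed X be (fun y => p (Y y) (al y)) x -
  mixed Y al (fun y => p (X y) (be y)) x + mixed Y be (fun y => p (X y) (al y)) x.
Proof.
move=> sX sY sal sbe.
have qf (Z : sec A) (ga : sec B) : (fun y => q (ga y) (Z y)) = fun y => p (Z y) (ga y).
  by apply/funext => y; rewrite qp.
have sXY := bracket_smooth LA sX sY; have sab := bracket_smooth LB sal sbe.
rewrite (defectE dp dq)// (defectE dq dp)//.
rewrite !(lie_half_expand dp dq qp)// !(lie_half_expand dq dp pq)//.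
rewrite !(dX0E dp dq)// !(dX0E dq dp)//.
rewrite !qp !qf /mixed (bracketC LA x sY sX) (bracketC LB x sbe sal).
by rewrite !(pairingNl dp) !(pairingNr dp); ring.
Qed.

End Duality.

(** * The Lie derivative axiom in degrees 0 and 1 *)

Section LieCondition.
Variables (R : realType) (M : manifold R) (A B : bundle M).
Variables (p : forall x, A x -> B x -> R) (q : forall x, B x -> A x -> R).
Hypotheses (dp : dual_pairing p) (dq : dual_pairing q).
Variables (LA : lie_algebroid A) (LB : lie_algebroid B) (S : schouten p LA).
Variables (phi0 : sec B) (X0 : sec A).
Hypotheses (sphi : smooth_sec phi0) (sX0 : smooth_sec X0).
Implicit Types (X Y Z : sec A) (al be : sec B) (P : cochain B) (als : seq (sec B)).

Definition lie_sum k P : cochain B :=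
  cochainD (tlie LB (of_sec p X0) phi0 P) (tsch S phi0 1 k (of_sec p X0) P).

(** With i the contraction by phi0, i(X0 /\ P) + X0 /\ iP = <X0, phi0> P; Cartan's formula accounts
    for the rest. *)
Lemma tlie_eval k P als x : is_form k P -> all_smooth als ->
  tlie LB (of_sec p X0) phi0 P (eval_at x als) =
  lie LB x phi0 P als + p (X0 x) (phi0 x) * P x (eval_at x als).
Proof.
move=> fP sals; rewrite -(cartan LB dq x fP sphi sals) /tlie /tdiff /cochainD.
have := congr1 (fun w : cochain B => w x (eval_at x als))
  (contract_wedge_of_sec p phi0 X0 P).
rewrite /contract /cochainD /cochainZ /scale_form => ->.
by ring.
Qed.

(** The coefficient k - 2 combines k - 1 from the twisted bracket with the single <X0, phi0> P of
    [tlie_eval], of opposite sign. *)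
Lemma lie_sum_eval k P als x : is_form k P -> all_smooth als -> size als = k ->
  lie_sum k P (eval_at x als) = lie LB x phi0 P als +
    lie_ev x (anchor LA (X0 x)) (lie_derivative p LA X0) P als -
    (k%:R - 2) * p (X0 x) (phi0 x) * P x (eval_at x als).
Proof.
move=> fP sals sz; rewrite /lie_sum /cochainD (tlie_eval x fP)//.
by rewrite (tsch_eval dp S phi0 x sX0 fP)//; ring.
Qed.

Lemma lie_sum_degree k P x (s : seq (B x)) : is_form k P -> size s != k ->
  lie_sum k P s = 0.
Proof.
move=> fP sk; rewrite /lie_sum /cochainD.
rewrite (form_degree (is_form_tsch dp S sphi sX0 fP) sk) addr0.
have [j fj sj] : exists2 j, is_form j (contract phi0 P) & size s != j.+1.
  case: k fP sk => [|k] fP sk; last by exists k => //; exact: (is_form_contract fP sphi).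
  (* In degree 0 the contraction is zero, a form of any degree; [size s] is chosen as a degree j for
     which s cannot have length j + 1. *)
  exists (size s); last by rewrite neq_ltn leqnn.
  rewrite (_ : contract phi0 P = cochain0 B); first exact: is_form0.
  by apply: cochain_ext => y t; rewrite /contract (form_degree fP).
rewrite /tlie /tdiff /cochainD /contract.
rewrite (diff_degree LB fj sj) (form_degree (is_form_wedge_of_sec dp sX0 fj) sj).
rewrite (diff_degree LB fP)//= (form_degree (is_form_wedge_of_sec dp sX0 fP))//.
by rewrite !addr0.
Qed.

Hypothesis lie0 : forall k P, is_form k P -> lie_sum k P = cochain0 B.

Lemma lie0_fun f x : smooth f -> anchor LB (phi0 x) f + anchor LA (X0 x) f +
  2 * p (X0 x) (phi0 x) * f x = 0.
Proof.
move=> sf; have fP := is_form_of_fun B sf.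
have := @lie_sum_eval 0 _ [::] x fP Logic.I erefl.
by rewrite (lie0 fP) /cochain0 /lie /= => ->; ring.
Qed.

(** On the function 1 both anchors vanish and only 2 <X0, phi0> remains. *)
Lemma lie0_pairing x : p (X0 x) (phi0 x) = 0.
Proof.
have := lie0_fun x (@smooth_cst R M 1); rewrite !anchor_cst => h; lra.
Qed.

Lemma lie0_anchor f x : smooth f -> anchor LB (phi0 x) f = - anchor LA (X0 x) f.
Proof. by move=> sf; have := lie0_fun x sf; rewrite lie0_pairing => h; lra. Qed.

Lemma lie0_sec X al x : smooth_sec X -> smooth_sec al ->
  anchor LB (phi0 x) (fun y => p (X y) (al y)) - p (X x) (bracket LB phi0 al x) +
  p (bracket LA X0 X x) (al x) = 0.
Proof.
move=> sX sal; have fP := is_form_of_sec dp sX.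
have := @lie_sum_eval 1 _ [:: al] x fP (conj sal Logic.I) erefl.
rewrite (lie0 fP) /cochain0 lie0_pairing (lie_ev_of_sec dp LA)// /lie /= /contract => h.
by rewrite h; ring.
Qed.

End LieCondition.

(** [lie_ev] is linear in the pair [(D, del)], so what happens on functions and sections decides
    every degree. *)
Lemma lie_ev_opp (R : realType) (M : manifold R) (E : bundle M) x (D1 D2 : (M -> R) -> R)
    (del1 del2 : sec E -> sec E) k (w : cochain E) Xs :
  (forall f, smooth f -> D1 f = - D2 f) ->
  (forall X, smooth_sec X -> del1 X x = - del2 X x) ->
  is_form k w -> all_smooth Xs -> lie_ev x D1 del1 w Xs = - lie_ev x D2 del2 w Xs.
Proof.
move=> D12 d12; elim: Xs k w => [|X Xs IH] k w fw /=.
  by move=> _; apply: D12; exact: (@form_smooth_eval _ _ _ _ _ [::] fw Logic.I).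
move=> [sX sXs]; rewrite (IH _ _ (is_form_contract fw sX))// d12//.
by rewrite (form_headN (form_multilinear x fw)); ring.
Qed.

(** * From the axioms to the dual axioms *)

Section Duality.
Variables (R : realType) (M : manifold R) (A B : bundle M).
Variables (p : forall x, A x -> B x -> R) (q : forall x, B x -> A x -> R).
Hypotheses (dp : dual_pairing p) (dq : dual_pairing q).
Hypothesis qp : forall x u l, q (x := x) l u = p u l.
Variables (LA : lie_algebroid A) (LB : lie_algebroid B).
Variables (SA : schouten p LA) (SB : schouten q LB).
Variables (phi0 : sec B) (X0 : sec A).
Hypotheses (sphi : smooth_sec phi0) (sX0 : smooth_sec X0).
Implicit Types (X Y Z : sec A) (al be : sec B) (f g : M -> R).

Hypothesis lie0 : forall k P, is_form k P -> lie_sum LB SA phi0 X0 k P = cochain0 B.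

Lemma lie_sum_dual k P : is_form k P -> lie_sum LA SB X0 phi0 k P = cochain0 A.
Proof.
move=> fP; apply: cochain_ext => x s.
have [sk|sk] := eqVneq (size s) k; last exact: (lie_sum_degree dq LA SB sX0 sphi fP sk).
have [sXs eXs] := eval_sec_through dp s; set Xs := map _ s in sXs eXs.
have szXs : size Xs = k by rewrite /Xs size_map.
rewrite -eXs (lie_sum_eval dq dp LA SB sX0 sphi x fP sXs szXs).
rewrite qp (lie0_pairing dp dq sphi sX0 lie0) mulr0 mul0r subr0 /lie.
rewrite (@lie_ev_opp _ _ _ x (anchor LA (X0 x)) (anchor LB (phi0 x)) _
  (lie_derivative q LB phi0) k P Xs) ?addNr//.
  move=> f sf; rewrite (lie0_anchor dp dq sphi sX0 lie0)// opprK //.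
move=> X sX; apply: (pairing_nondegenerate dp) => l.
have [sl <-] := sec_throughP dq l; set al := sec_through l.
rewrite (pairingNl dp) -[p (lie_derivative _ _ _ _ _) _]qp.
rewrite (lie_derivativeE dq LB x sphi sX sl) qp.
have := lie0_sec dp dq sphi sX0 lie0 x sX sl.
rewrite (_ : (fun y => q (sec_through l y) (X y)) = fun y => p (X y) (al y)).
  rewrite /al => h; lra.
by apply/funext => y; rewrite qp.
Qed.

Hypothesis defect0 : forall X Y, smooth_sec X -> smooth_sec Y ->
  defect LB SA phi0 X0 X Y = cochain0 B.

Local Notation obs := (obstruction p LA LB phi0 X0).

Lemma obstruction_wedge X f al be Y x : smooth f -> smooth_sec X -> smooth_sec Y ->
  smooth_sec al -> smooth_sec be ->
  obs X f al x * p (Y x) (be x) = obs X f be x * p (Y x) (al x).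
Proof.
move=> sf sX sY sal sbe.
have := defect_scale dp dq qp LB SA phi0 sX0 x sf sX sY sal sbe.
rewrite !defect0//; last exact: smooth_secZ.
by rewrite /cochain0 => h; lra.
Qed.

(* When the rank is 1 the bracket axiom is void, so obstruction0 needs two
   independent vectors at x; on dependent vectors any 2-form vanishes. *)
Section Independent.
Variables (x : M) (u v : sec A) (al0 be0 : sec B).
Hypotheses (su : smooth_sec u) (sv : smooth_sec v).
Hypotheses (sal0 : smooth_sec al0) (sbe0 : smooth_sec be0).
Hypothesis det_neq0 :
  p (u x) (al0 x) * p (v x) (be0 x) - p (u x) (be0 x) * p (v x) (al0 x) != 0.

Lemma obstruction0 X f al : smooth f -> smooth_sec X -> smooth_sec al ->
  obs X f al x = 0.
Proof.
move=> sf sX sal.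
have hu := obstruction_wedge x sf sX su sal0 sbe0.
have hv := obstruction_wedge x sf sX sv sal0 sbe0.
(* Cramer's rule: hu and hv form a homogeneous linear system in the values of O on al0 and be0, with
   nonzero determinant. *)
have a0 : obs X f al0 x = 0.
  apply: (mulIf det_neq0); rewrite mul0r.
  by rewrite mulrBr mulrCA hv mulrA [X in _ - X]mulrA hu; ring.
have b0 : obs X f be0 x = 0.
  apply: (mulIf det_neq0); rewrite mul0r.
  by move: hu hv; rewrite a0 !mul0r => hu hv; rewrite mulrBr mulrA -hu mulrCA -hv; ring.
have ka := obstruction_wedge x sf sX su sal sal0.
have kb := obstruction_wedge x sf sX su sal sbe0.
move: ka kb; rewrite a0 b0 !mul0r => ka kb.
apply: (mulIf det_neq0); rewrite mul0r.
by rewrite mulrBr mulrA ka mulrA kb; ring.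
Qed.

Lemma gradient_skew f g : smooth f -> smooth g ->
  anchor LB (gradient p LA f x) g + anchor LB (gradient p LA g x) f = 0.
Proof.
move=> sf sg; set c := _ + _.
have h Z ga : smooth_sec Z -> smooth_sec ga -> c * p (Z x) (ga x) = 0.
  move=> sZ sga; have := obstruction_scale dp dq qp LA LB phi0 X0 x sf sg sZ sga.
  rewrite !obstruction0//; last exact: smooth_secZ.
  by rewrite mulr0 add0r => <-.
apply: (mulIf det_neq0); rewrite mul0r mulrBr !mulrA !h//; ring.
Qed.

Lemma defect_dual_independent al be X Y : smooth_sec al -> smooth_sec be ->
  smooth_sec X -> smooth_sec Y -> defect LA SB X0 phi0 al be [:: X x; Y x] = 0.
Proof.
move=> sal sbe sX sY.
have mixedE Z ga f : smooth_sec Z -> smooth_sec ga -> smooth f ->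
    mixed p q LA LB phi0 X0 Z ga f x =
    - anchor LB (gradient p LA f x) (fun y => p (Z y) (ga y)) -
    anchor LA (X0 x) f * p (Z x) (ga x) +
    f x * anchor LA (X0 x) (fun y => p (Z y) (ga y)).
  move=> sZ sga sf; have := obstructionE dp dq qp LA LB phi0 sX0 x sf sZ sga.
  rewrite obstruction0// /mixed => h.
  have sp := pairing_smooth dp sZ sga.
  have := lie0_sec dp dq sphi sX0 lie0 x sZ sga.
  rewrite (lie0_anchor dp dq sphi sX0 lie0)//.
  rewrite (bracketC LB x sphi sga) (bracketC LA x sX0 sZ).
  rewrite (pairingNr dp) (pairingNl dp) => k.
  (* By the degree 1 condition, the zero-order coefficient of [mixed] is the derivative of <Z, ga>
     along X0. *)
  rewrite (_ : p (Z x) (bracket LB ga phi0 x) - p (bracket LA Z X0 x) (ga x) =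
    anchor LA (X0 x) (fun y => p (Z y) (ga y))); last by lra.
  by lra.
have := defect_duality dp dq qp SA SB sphi sX0 x sX sY sal sbe.
rewrite defect0// /cochain0 sub0r => /eqP; rewrite eqr_oppLR => /eqP ->.
have sp Z ga : smooth_sec Z -> smooth_sec ga -> smooth (fun y => p (Z y) (ga y)).
  by move=> *; exact: (pairing_smooth dp).
rewrite !mixedE//; [|exact: sp..].
(* The four terms cancel in pairs: E(X, al)<Y, be> with E(Y, be)<X, al>, and E(X, be)<Y, al> with
   E(Y, al)<X, be>. *)
have k1 := gradient_skew (sp X al sX sal) (sp Y be sY sbe).
have k2 := gradient_skew (sp X be sX sbe) (sp Y al sY sal).
by lra.
Qed.

End Independent.

Lemma defect_dual al be : smooth_sec al -> smooth_sec be ->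
  defect LA SB X0 phi0 al be = cochain0 A.
Proof.
move=> sal sbe; apply: cochain_ext => x s.
have fD := is_form_defect dq dp LA SB sX0 sphi sal sbe.
have mD := form_multilinear x fD.
have [s2|s2] := eqVneq (size s) 2; last exact: (form_degree fD).
case: s s2 => [|u [|v [|w s]]]//= _.
have [[l [m lm]]|dep] := pselect (exists l m, p u l * p v m - p u m * p v l != 0).
  have [su eu] := sec_throughP dp u; have [sv ev] := sec_throughP dp v.
  have [sl el] := sec_throughP dq l; have [sm em] := sec_throughP dq m.
  rewrite -{1}eu -{1}ev; apply: (@defect_dual_independent x (sec_through u)
    (sec_through v) (sec_through l) (sec_through m)) => //.
  by rewrite eu ev el em.
have {}dep l m : p u l * p v m = p u m * p v l.
  apply/eqP; rewrite -subr_eq0; apply: contrapT => lm; apply: dep.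
  by exists l, m; apply/negP.
have [[l ul]|u0] := pselect (exists l, p u l != 0).
  (* The vanishing of all 2 x 2 minors, with one nonzero coordinate of u, makes v this multiple of
     u. *)
  have -> : v = (p v l / p u l) *: u.
    apply: (pairing_nondegenerate dp) => m; rewrite (pairingZl dp).
    by apply: (mulfI ul); rewrite dep; field.
  rewrite form_swap// form_headZ//.
  by rewrite (mD.2 [::] [::] [::] u) mulr0 oppr0.
have -> : u = 0.
  apply: (pairing_nondegenerate dp) => l; rewrite (pairing0l dp).
  by apply/eqP; apply: contrapT => ul; apply: u0; exists l; apply/negP.
exact: form_head0.
Qed.

End Duality.

Theorem theorem4p13 (R : realType) (M : manifold R) (A : bundle M)
  (LA : lie_algebroid A) (LAs : lie_algebroid (dual A))
  (SA : schouten (@ev R M A) LA) (SAs : schouten (@coev R M A) LAs)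
  (phi0 : sec (dual A)) (X0 : sec A) :
  gen_lie_bialgebroid LA LAs SA phi0 X0 ->
  gen_lie_bialgebroid LAs LA SAs X0 phi0.
Proof.
case=> sphi sX0 cphi cX0 hbr hlie.
have dp := ev_dual_pairing A.
have dq : dual_pairing (@coev R M A) := dual_pairing_sym dp.
have qp x u l : coev (x := x) l u = @ev R M A x u l by [].
have d0 X Y : smooth_sec X -> smooth_sec Y ->
    defect LAs SA phi0 X0 X Y = cochain0 (dual A).
  move=> sX sY; rewrite /defect /dX0 hbr//; apply: cochain_ext => x s.
  by rewrite /cochainD /cochainZ /cochain0; ring.
(* Exchanging the roles swaps the smoothness and cocycle conditions up to conversion, as [coev] is
   [ev] with its arguments flipped. *)
split=> //.
- move=> al be sal sbe.
  have := defect_dual dp dq qp SAs sphi sX0 hlie d0 sal sbe => h.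
  apply: cochain_ext => x s.
  have := congr1 (fun w : cochain A => w x s) h.
  by rewrite /defect /dX0 /cochainD /cochainZ /cochain0 => k; lra.
- move=> k P fP.
  exact: (lie_sum_dual dp dq qp SAs sphi sX0 hlie fP).
Qed.
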